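(* Let $g\in\mathrm{Cvx}_0(\mathbb R^n)\cap C^2(\mathbb R^n\setminus\{0\})$, and let $f\in\mathcal S_2(\mathbb R^n)$ be nonlinear at infinity. Then the equation $$\frac1u\frac{\partial u}{\partial t}+u_t^\star(\nabla u)\,g\!\left(\frac{\nabla u}{u_t^\star(\nabla u)}\right)=0,\qquad u(0,x)=f(x),$$ (on $t\ge 0$, $x\neq 0$) admits a unique nonlinear-at-infinity solution $u(t)\in\mathcal S_2(\mathbb R^n)$, given by $$u(t,x)=\Big(f\boxdot\frac1t\,g^\circ\Big)(x).$$ In particular, there exists a solution for all time $t\ge0$.
   Context: $\mathrm{Cvx}_0(\mathbb R^n)$ is the set of convex lower semi-continuous $f:\mathbb R^n\to[0,+\infty]$ with $f(0)=0$. The polar of $f$ is $f^\circ(y)=\inf\{c\ge0:\langle x,y\rangle\le1+cf(x)\ \forall x\in\mathbb R^n\}$, and its Legendre transform is $f^\star(y)=\sup_x(\langle x,y\rangle-f(x))$. Define $a\boxdot b=(a^\circ+b^\circ)^\circ$; thus $f\boxdot\frac1tg^\circ=(f^\circ+tg)^\circ$ for $t>0$, and at $t=0$ the expression is understood as $f$. $\mathcal S_1(\mathbb R^n)$ is the class of $f\in\mathrm{Cvx}_0(\mathbb R^n)$ that are finite everywhere, continuously differentiable on $\mathbb R^n\setminus\{0\}$ and strictly convex (the graph contains no segment). $\mathcal S_2(\mathbb R^n)\subset\mathcal S_1(\mathbb R^n)$ is the subclass of functions twice continuously differentiable on $\mathbb R^n\setminus\{0\}$ with $\nabla^2f(x)>0$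 for all $x\ne0$. A function $f\in\mathrm{Cvx}_0(\mathbb R^n)$ is nonlinear at infinity if for every ray $\mathbb R^+x$ ($x\ne0$) the one-dimensional function $t\mapsto f(tx)$, $t\in\mathbb R^+$, is finite on all of $\mathbb R^+$ and is not between $h(t)=at$ and $h(t)-b$ for any $a\ge0$, $b>0$ (i.e. there are no such $a,b$ with $at-b\le f(tx)\le at$ for all $t\ge0$). Here $u(t)=u_t=u(t,\cdot)$ (a subscript $t$ is not a derivative), $\nabla$ is the gradient in $x$, $u_t^\star=(u_t)^\star$. A nonlinear-at-infinity solution $u(t)\in\mathcal S_2$ is a function $u\in C^2([0,\infty)\times(\mathbb R^n\setminus\{0\}))$ with $u(t,\cdot)\in\mathcal S_2(\mathbb R^n)$ nonlinear at infinity for each $t$, satisfying the equation at all $t\ge0$, $x\ne0$ (one-sided $t$-derivative at $t=0$). *)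

(* Defs.v *)
From HB Require Import structures.
From mathcomp Require Import all_boot all_order all_algebra.
From mathcomp Require Import all_classical all_reals all_analysis.

Set Implicit Arguments.
Unset Strict Implicit.
Unset Printing Implicit Defensive.

Import Order.TTheory GRing.Theory Num.Theory.
Import numFieldNormedType.Exports.

Local Open Scope classical_set_scope.
Local Open Scope ring_scope.

Section ConvexFunctions.
Context {R : realType} {n : nat}.
Local Notation V := 'rV[R]_n.
Implicit Types (f g : V -> \bar R) (x y : V).

Definition dot x y : R := \sum_(i < n) x 0 i * y 0 i.

Definition econvex f : Prop :=
  forall x y (t : R), 0 <= t <= 1 ->
    (f (t *: x + (1 - t) *: y)%R <= t%:E * f x + (1 - t)%:E * f y)%E.

Definition Cvx0 f : Prop :=
  [/\ forall x, (0 <= f x)%E, econvex f, lower_semicontinuous f & f 0 = 0%E].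

(* The product 0 * +oo is 0 here. The convention is immaterial: if c = 0 is
   admissible under either convention then so is every c > 0, and the infimum
   is 0. The infimum of the empty set is +oo. *)
Definition polar f : V -> \bar R := fun y =>
  ereal_inf [set c%:E | c in [set c : R |
    0 <= c /\ forall x, ((dot x y)%:E <= 1%:E + c%:E * f x)%E]].

Definition legendre f : V -> \bar R := fun y =>
  ereal_sup [set ((dot x y)%:E - f x)%E | x in [set: V]].

Definition boxdot f g : V -> \bar R :=
  polar (fun y => polar f y + polar g y)%E.

Definition nonlinear_at_infinity f : Prop :=
  forall x, x != 0 ->
    (forall t : R, 0 <= t -> f (t *: x) \is a fin_num) /\
    ~ exists a b : R, [/\ 0 <= a, 0 < b &
        forall t : R, 0 <= t ->
          ((a * t - b)%:E <= f (t *: x)%R /\ f (t *: x)%R <= (a * t)%:E)%E].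

Definition strictly_convex f : Prop :=
  forall x y (t : R), x != y -> 0 < t < 1 ->
    (f (t *: x + (1 - t) *: y)%R < t%:E * f x + (1 - t)%:E * f y)%E.

End ConvexFunctions.

Section Smoothness.
Context {R : realType} {n : nat}.
Local Notation V := 'rV[R]_n.
Implicit Types (phi : V -> R) (F : R -> V -> R).

Definition basis_vec (i : 'I_n) : V := delta_mx 0 i.

Definition partial (i : 'I_n) phi : V -> R := 'D_(basis_vec i) phi.

Definition grad phi (x : V) : V := \row_i partial i phi x.

Definition hessian phi (x : V) : 'M[R]_n :=
  \matrix_(i, j) partial i (partial j phi) x.

Definition pos_def (A : 'M[R]_n) : Prop :=
  forall v : V, v != 0 -> 0 < dot (v *m A) v.

(* Smoothness on the open set V \ {0}. *)
Definition C1_off0 phi : Prop :=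
  forall x, x != 0 ->
    {for x, continuous phi} /\
    forall i, derivable phi x (basis_vec i) /\ {for x, continuous (partial i phi)}.

Definition C2_off0 phi : Prop :=
  C1_off0 phi /\ forall i, C1_off0 (partial i phi).

(* Smoothness on [0, +oo) x (V \ {0}), which contains the face t = 0: the
   increments h of the time variable are restricted to t + h >= 0, so that the
   time derivative is two-sided for t > 0 and the right derivative at t = 0. *)
Definition spacetime : set (R * V) := [set p | 0 <= p.1 /\ p.2 != 0].

Definition dt_quotient F (t : R) (x : V) : R -> R :=
  fun h => h^-1 * (F (h + t) x - F t x).

Definition dt_filter (t : R) : set_system R :=
  within [set h : R | 0 <= h + t] (0 : R)^'.

Definition dt_derivable F (t : R) (x : V) : Prop :=
  cvg (dt_quotient F t x h @[h --> dt_filter t]).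

Definition dt F (t : R) (x : V) : R :=
  lim (dt_quotient F t x h @[h --> dt_filter t]).

Definition dx (i : 'I_n) F (t : R) : V -> R := partial i (F t).

Definition C0_spacetime F : Prop :=
  {within spacetime, continuous (fun p : R * V => F p.1 p.2)}.

Definition C1_spacetime F : Prop :=
  [/\ C0_spacetime F,
      forall (t : R) (x : V), 0 <= t -> x != 0 ->
        dt_derivable F t x /\ forall i, derivable (F t) x (basis_vec i),
      C0_spacetime (dt F) &
      forall i, C0_spacetime (dx i F)].

Definition C2_spacetime F : Prop :=
  [/\ C1_spacetime F, C1_spacetime (dt F) & forall i, C1_spacetime (dx i F)].

End Smoothness.

Section Classes.
Context {R : realType} {n : nat}.
Local Notation V := 'rV[R]_n.
Implicit Types (f g : V -> \bar R).

(* A function with values in [0, +oo] is finite and twice continuously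
   differentiable off 0. *)
Definition eC2_off0 f : Prop :=
  (forall x, x != 0 -> f x \is a fin_num) /\ C2_off0 (fine \o f).

Definition S1 f : Prop :=
  [/\ Cvx0 f, forall x, f x \is a fin_num, C1_off0 (fine \o f) &
      strictly_convex f].

Definition S2 f : Prop :=
  [/\ S1 f, C2_off0 (fine \o f) &
      forall x, x != 0 -> pos_def (hessian (fine \o f) x)].

Definition realpart (u : R -> V -> \bar R) : R -> V -> R :=
  fun t x => fine (u t x).

(* The equation is written in R. No value is lost in [fine]: for u t in S1 and
   x != 0, convexity gives that the Legendre transform of u t is attained at x
   for the slope grad (u t) x, hence finite, and strict convexity makes it
   positive; likewise u t x > 0; and g is finite in the theorem. *)
Definition polar_HJ g (u : R -> V -> \bar R) (t : R) (x : V) : Prop :=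
  let U := realpart u in
  let p := grad (U t) x in
  let s := fine (legendre (u t) p) in
  (U t x)^-1 * dt U t x + s * fine (g (s^-1 *: p)) = 0.

(* Only the values u t with 0 <= t matter. *)
Definition is_solution g f (u : R -> V -> \bar R) : Prop :=
  [/\ C2_spacetime (realpart u),
      forall t : R, 0 <= t -> S2 (u t) /\ nonlinear_at_infinity (u t),
      forall (t : R) (x : V), 0 <= t -> x != 0 -> polar_HJ g u t x &
      forall x, u 0 x = f x].

Definition flow f g (t : R) : V -> \bar R :=
  if t == 0 then f else boxdot f (fun x => (t^-1)%:E * polar g x)%E.

End Classes.

Section GraphSegment.
Context {R : realType} {n : nat}.
Local Notation V := 'rV[R]_n.

(* For a finite convex function, strict convexity is the absence of segments
   in the graph. *)
Lemma strictly_convexP (f : V -> \bar R) :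
  econvex f -> (forall x, f x \is a fin_num) ->
  strictly_convex f <->
  ~ exists x y : V, x != y /\ forall t : R, 0 <= t <= 1 ->
      f (t *: x + (1 - t) *: y) = (t%:E * f x + (1 - t)%:E * f y)%E.
Proof.
move=> cf ff; set F := fine \o f.
have fE x : f x = (F x)%:E by rewrite /F /= fineK.
have cF x y t : 0 <= t <= 1 ->
    F (t *: x + (1 - t) *: y) <= t * F x + (1 - t) * F y.
  by move=> t01; have := cf x y t t01; rewrite !fE -!EFinM -EFinD lee_fin.
split=> [sf [x [y [xy seg]]]|noseg x y t xy /andP[t0 t1]].
  have h : 0 < (2^-1 : R) < 1 by rewrite invr_gt0 ltr0n invf_lt1 ?ltr0n// ltr1n.
  have := sf x y _ xy h.
  by rewrite seg ?ltxx//; case/andP: h => h0 h1; rewrite !ltW.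
rewrite ltNge; apply/negP => ge; apply: noseg; exists x, y; split => // s s01.
move: ge; rewrite !fE -!EFinM -!EFinD lee_fin => ge; congr EFin.
apply/eqP; rewrite eq_le cF//= leNgt; apply/negP => lt.
case/andP: (s01) => s0 s1.
set z := s *: x + (1 - s) *: y in lt.
have [st|ts] := leP s t.
- (* t is between s and 1 *)
  have d0 : 0 < 1 - s by rewrite subr_gt0 (le_lt_trans st).
  pose l := (1 - t) / (1 - s).
  have l0 : 0 < l by apply: divr_gt0 => //; rewrite subr_gt0.
  have l1 : l <= 1 by rewrite ler_pdivrMr// mul1r lerD2l lerN2.
  have lE : l * (1 - s) = 1 - t by rewrite divfK ?gt_eqF.
  have ls : l * s + (1 - l) = t.
    have -> : l * s = l - (1 - t) by rewrite -lE mulrBr mulr1 subKr.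
    by rewrite addrC addrA subrK subKr.
  have zE : t *: x + (1 - t) *: y = l *: z + (1 - l) *: x.
    by rewrite scalerDr !scalerA lE addrAC -scalerDl ls.
  have := cF z x l; rewrite (ltW l0) l1 => /(_ erefl); rewrite -zE => le1.
  have: l * F z + (1 - l) * F x < t * F x + (1 - t) * F y.
    apply: (@lt_le_trans _ _ (l * (s * F x + (1 - s) * F y) + (1 - l) * F x)).
      by rewrite ltrD2r ltr_pM2l.
    by rewrite mulrDr !mulrA lE addrAC -mulrDl ls.
  by move=> /(le_lt_trans le1)/(le_lt_trans ge); rewrite ltxx.
- have s0' : 0 < s by rewrite (lt_trans t0).
  pose l := t / s.
  have l0 : 0 < l by apply: divr_gt0.
  have l1 : l <= 1 by rewrite ler_pdivrMr// mul1r ltW.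
  have lE : l * s = t by rewrite divfK ?gt_eqF.
  have ls : l * (1 - s) + (1 - l) = 1 - t.
    by rewrite mulrBr mulr1 lE addrC addrA subrK.
  have zE : t *: x + (1 - t) *: y = l *: z + (1 - l) *: y.
    by rewrite scalerDr !scalerA lE -addrA -scalerDl ls.
  have := cF z y l; rewrite (ltW l0) l1 => /(_ erefl); rewrite -zE => le1.
  have: l * F z + (1 - l) * F y < t * F x + (1 - t) * F y.
    apply: (@lt_le_trans _ _ (l * (s * F x + (1 - s) * F y) + (1 - l) * F y)).
      by rewrite ltrD2r ltr_pM2l.
    by rewrite mulrDr !mulrA lE -addrA -mulrDl ls.
  by move=> /(le_lt_trans le1)/(le_lt_trans ge); rewrite ltxx.
Qed.

End GraphSegment.

(* Main.v *)
(* The polars f and h of each other are related by contact points: for x <> 0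
   the supremum of (<x, y> - 1) / h(y) is attained at exactly one y
   (nonlinearity at infinity provides the compactness), and the relation between
   x and y is symmetric in h and its polar. For a family H_t the contact point
   Y(t, x) is continuous in (t, x), and the envelope theorem gives the first
   derivatives of u_t, the polar of H_t:
     grad u = Y / H(t, Y),   d_t u = - u d_t H(t, Y) / H(t, Y).
   As x / u = grad H(t, Y) and the Hessian of H_t is invertible, Y is C^1 in
   (t, x), hence u is C^2. Since 1 / H(t, Y) is the Legendre transform of u_t at
   grad u, the equation says that d_t H = g. Existence is the case of
   H_t = f^polar + t g. Conversely the polars of a solution u_t satisfy
   d_t (u_t)^polar = g, so that they are f^polar + t g, and biduality gives u_t. *)
Require Import Defs.
From mathcomp Require Import all_boot all_order all_algebra.
From mathcomp Require Import all_classical all_reals all_analysis.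
From mathcomp Require Import ring lra.
Set Implicit Arguments.
Unset Strict Implicit.
Unset Printing Implicit Defensive.
Import Order.TTheory GRing.Theory Num.Theory.
Import numFieldNormedType.Exports.
Local Open Scope classical_set_scope.
Local Open Scope ring_scope.

(** * Strict differentiability *)

(** The estimates rest on the intercept [itc phi x], for convex [phi] the Legendre transform at
    [grad phi x]. It is nondecreasing along rays, and for the functions considered nonlinearity at
    infinity amounts to its unboundedness on every ray; compactness of the sphere makes this uniform
    in the direction. At a contact point the intercept is the reciprocal of the polar, so a lower
    bound on the polar confines contact points to a ball. The same reciprocity passes nonlinearity
    on to the polar. The regularity hypotheses speak of partial derivatives on a set with a boundary
    face t = 0 and a missing axis x = 0. They are converted once into strict differentiability,
    where chain rule, product rule and implicit differentiation are uniform estimates over pairs of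
    points. Contact points are known to be continuous before they are differentiated, so a given
    solution of the implicit equation is linearized. Every nonzero y is the contact point of its
    gradient divided by its intercept; this gives biduality for f and u_t. The function g may vanish
    off 0 or be linear on rays, and gets a bipolar statement of its own. *)

Section BoundedLinear.
Context {R : realType}.

Definition blin (E G : normedModType R) (L : E -> G) : Prop :=
  (forall (a : R) u v, L (a *: u + v) = a *: L u + L v) /\
  exists2 C : R, 0 <= C & forall v, `|L v| <= C * `|v|.

Context {E G H : normedModType R}.
Implicit Types (L : E -> G).

Lemma blinD L u v : blin L -> L (u + v) = L u + L v.
Proof. by case=> lL _; have := lL 1 u v; rewrite !scale1r. Qed.

Lemma blin0 L : blin L -> L 0 = 0.
Proof. by move=> bL; apply: (addrI (L 0)); rewrite -(blinD _ _ bL) !addr0. Qed.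

Lemma blinZ L a u : blin L -> L (a *: u) = a *: L u.
Proof.
by move=> bL; have := bL.1 a u 0; rewrite !addr0 (blin0 bL) addr0.
Qed.

Lemma blinB L u v : blin L -> L (u - v) = L u - L v.
Proof. by move=> bL; rewrite blinD// -scaleN1r blinZ// scaleN1r. Qed.

Lemma blin_cst0 : blin (fun _ : E => 0 : G).
Proof.
split=> [a u v|]; first by rewrite scaler0 addr0.
by exists 0 => // v; rewrite normr0 mul0r.
Qed.

Lemma blin_add L1 L2 : blin L1 -> blin L2 -> blin (fun v => L1 v + L2 v).
Proof.
move=> [l1 [C1 C10 h1]] [l2 [C2 C20 h2]]; split=> [a u v|].
  by rewrite l1 l2 scalerDr addrACA.
exists (C1 + C2); first exact: addr_ge0.
by move=> v; rewrite (le_trans (ler_normD _ _))// mulrDl lerD.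
Qed.

Lemma blin_comp L (M : G -> H) : blin L -> blin M -> blin (fun v => M (L v)).
Proof.
move=> [l1 [C1 C10 h1]] [l2 [C2 C20 h2]]; split=> [a u v|].
  by rewrite l1 l2.
exists (C2 * C1); first exact: mulr_ge0.
by move=> v; rewrite (le_trans (h2 _))// -mulrA ler_wpM2l.
Qed.

Lemma blin_scale L (c : R) : blin L -> blin (fun v => c *: L v).
Proof.
move=> [l1 [C1 C10 h1]]; split=> [a u v|].
  by rewrite l1 scalerDr !scalerA mulrC.
exists (`|c| * C1); first exact: mulr_ge0.
by move=> v; rewrite normrZ -mulrA ler_wpM2l.
Qed.

End BoundedLinear.

Section ProductLinear.
Context {R : realType} {E F G : normedModType R}.

Lemma norm_fst_le (p : E * F) : `|p.1| <= `|p|.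
Proof. by rewrite prod_normE le_max lexx. Qed.

Lemma norm_snd_le (p : E * F) : `|p.2| <= `|p|.
Proof. by rewrite prod_normE le_max lexx orbT. Qed.

Lemma blin_fst : blin (fst : E * F -> E).
Proof. by split=> //; exists 1 => // v; rewrite mul1r norm_fst_le. Qed.

Lemma blin_snd : blin (snd : E * F -> F).
Proof. by split=> //; exists 1 => // v; rewrite mul1r norm_snd_le. Qed.

Lemma blin_pair (L : G -> E) (M : G -> F) :
  blin L -> blin M -> blin (fun v => (L v, M v)).
Proof.
move=> [l1 [C1 C10 h1]] [l2 [C2 C20 h2]]; split=> [a u v|].
  by rewrite l1 l2.
exists (C1 + C2); first exact: addr_ge0.
move=> v; rewrite prod_normE/= ge_max mulrDl.
rewrite (le_trans (h1 v)) ?lerDl ?mulr_ge0//.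
by rewrite (le_trans (h2 v))// lerDr mulr_ge0.
Qed.

End ProductLinear.

Section StrictDifferentiability.
Context {R : realType}.

(* Strict differentiability relative to D. At all points of spacetime it is
   equivalent to C^1; the continuity of the derivatives comes for free, and the
   face t = 0 needs no special treatment. *)
Definition sdiff (E G : normedModType R) (D : set E) (F : E -> G) (p : E)
    (L : E -> G) : Prop :=
  [/\ D p, blin L & forall e, 0 < e -> exists2 d, 0 < d &
    forall a b, D a -> D b -> `|a - p| < d -> `|b - p| < d ->
      `|F a - F b - L (a - b)| <= e * `|a - b|].

Context {E G : normedModType R}.
Implicit Types (D : set E) (F : E -> G) (p : E) (L : E -> G).

Lemma within_cvgP D F p l : F @ within D (nbhs p) --> l <->
  (forall e : R, 0 < e -> exists2 d : R, 0 < d &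
     forall a, D a -> `|a - p| < d -> `|F a - l| < e).
Proof.
split=> [cF e e0|h].
  have /cvgrPdist_lt/(_ e e0) := cF.
  rewrite /within/= => /nbhs_normP[d /= d0 hd].
  exists d => // a Da ap; rewrite distrC; apply: hd => //=.
  by rewrite distrC.
apply/cvgrPdist_lt => e e0; have [d d0 hd] := h e e0.
apply/nbhs_normP; exists d => //= a ap Da.
by rewrite distrC hd// distrC.
Qed.

Lemma nbhs_cvgP F p l : F @ nbhs p --> l <->
  (forall e : R, 0 < e -> exists2 d : R, 0 < d &
     forall a, `|a - p| < d -> `|F a - l| < e).
Proof.
split=> [cF e e0|h].
  have /cvgrPdist_lt/(_ e e0)/nbhs_normP[d /= d0 hd] := cF.
  by exists d => // a ap; rewrite distrC; apply: hd => /=; rewrite distrC.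
apply/cvgrPdist_lt => e e0; have [d d0 hd] := h e e0.
by apply/nbhs_normP; exists d => //= a ap; rewrite distrC hd// distrC.
Qed.

Lemma sdiff_lip D F p L : sdiff D F p L -> exists2 C, 0 <= C & exists2 d, 0 < d &
  forall a b, D a -> D b -> `|a - p| < d -> `|b - p| < d ->
      `|F a - F b| <= C * `|a - b|.
Proof.
move=> [_ [_ [C C0 hC]] h]; have [d d0 hd] := h 1 ltr01.
exists (1 + C); first exact: addr_ge0.
exists d => // a b Da Db ap bp; rewrite -(subrK (L (a - b)) (F a - F b)).
by rewrite (le_trans (ler_normD _ _))// mulrDl lerD// hd.
Qed.

Lemma sdiff_cvg D F p L : sdiff D F p L -> F @ within D (nbhs p) --> F p.
Proof.
move=> dF; have [Dp _ _] := dF; have [C C0 [d d0 h]] := sdiff_lip dF.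
apply/within_cvgP => e e0.
have C1 : 0 < C + 1 by rewrite ltr_wpDl.
exists (Num.min d (e / (C + 1))); first by rewrite lt_min d0 divr_gt0.
move=> a Da; rewrite lt_min => /andP[ad ae].
rewrite (le_lt_trans (h a p _ _ _ _))// ?subrr ?normr0//.
rewrite ltr_pdivlMr// in ae; rewrite (le_lt_trans _ ae)// mulrC ler_wpM2l//.
by rewrite lerDl.
Qed.

Lemma eq_sdiff D F F' p L : (forall a, D a -> F a = F' a) ->
  sdiff D F p L -> sdiff D F' p L.
Proof.
move=> eF [Dp bL h]; split=> // e e0; have [d d0 hd] := h e e0.
by exists d => // a b Da Db ap bp; rewrite -!eF// hd.
Qed.

Lemma eq_sdiffr D F p L L' : (forall v, L v = L' v) ->
  sdiff D F p L -> sdiff D F p L'.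
Proof. by move=> /funext ->. Qed.

Lemma sdiff_blin D p L : D p -> blin L -> sdiff D L p L.
Proof.
move=> Dp bL; split=> // e e0; exists 1 => // a b _ _ _ _.
by rewrite -(blinB _ _ bL) subrr normr0 mulr_ge0// ltW.
Qed.

Lemma sdiff_cst D p (c : G) : D p -> sdiff D (fun=> c) p (fun=> 0).
Proof.
move=> Dp; split=> //; first exact: blin_cst0.
move=> e e0; exists 1 => // a b _ _ _ _.
by rewrite !subrr normr0 mulr_ge0// ltW.
Qed.

Lemma sdiff_add D F1 F2 p L1 L2 : sdiff D F1 p L1 -> sdiff D F2 p L2 ->
  sdiff D (fun a => F1 a + F2 a) p (fun v => L1 v + L2 v).
Proof.
move=> [Dp b1 h1] [_ b2 h2]; split => //; first exact: blin_add.
move=> e e0; have e20 : 0 < e / 2 by rewrite divr_gt0.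
have [d1 d10 {}h1] := h1 _ e20; have [d2 d20 {}h2] := h2 _ e20.
exists (Num.min d1 d2); first by rewrite lt_min d10.
move=> a b Da Db; rewrite !lt_min => /andP[a1 a2] /andP[bb1 bb2].
rewrite [e]splitr mulrDl.
have -> : F1 a + F2 a - (F1 b + F2 b) - (L1 (a - b) + L2 (a - b)) =
   (F1 a - F1 b - L1 (a - b)) + (F2 a - F2 b - L2 (a - b)).
  by rewrite opprD addrACA -[in RHS]addrACA opprD.
by rewrite (le_trans (ler_normD _ _))// lerD ?h1 ?h2.
Qed.

(** For a short step [h *: v] from [q] near [p], one increment of [F] is approximated both by [L q]
    and by [L p]; dividing by [h] shows that the two agree up to [e] at [v]. Only positive steps
    have to stay in [D], so the face t = 0 is covered. *)
Lemma sdiff_continuous D F (L : E -> E -> G) p v :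
  (forall q, D q -> sdiff D F q (L q)) -> D p ->
  (forall q, D q -> \forall h \near 0^'+, D (q + h *: v)) ->
  (fun q => L q v) @ within D (nbhs p) --> L p v.
Proof.
move=> dF Dp adm; apply/within_cvgP => e e0.
have [v0|v0] := eqVneq v 0.
  exists 1 => // a Da _.
  have [_ ba _] := dF a Da; have [_ bp _] := dF p Dp.
  by rewrite v0 (blin0 ba) (blin0 bp) subrr normr0.
have nv0 : 0 < `|v| by rewrite normr_gt0.
have e1 : 0 < e / 3 / `|v| by rewrite !divr_gt0.
have [_ bp /(_ _ e1)[d d0 hd]] := dF p Dp.
exists d => // q Dq qp; have [_ bq /(_ _ e1)[d' d'0 hd']] := dF q Dq.
have : \forall h \near 0^'+, [/\ D (q + h *: v), h * `|v| < d', 0 < h &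
    h * `|v| < d - `|q - p|].
  near=> h; split; first by near: h; exact: adm.
  - rewrite -ltr_pdivlMr//; near: h; apply: nbhs_right_lt; exact: divr_gt0.
  - by near: h; exact: nbhs_right_gt.
  - rewrite -ltr_pdivlMr//; near: h; apply: nbhs_right_lt.
    by rewrite divr_gt0// subr_gt0.
move=> /filter_ex[h [Dh hd1 h0 hd2]].
have nh : `|h *: v| = h * `|v| by rewrite normrZ gtr0_norm.
have qE : q + h *: v - q = h *: v by rewrite addrC addKr.
have A := hd (q + h *: v) q Dh Dq _ qp.
have B := hd' (q + h *: v) q Dh Dq _ _.
rewrite qE in A B; rewrite subrr normr0 nh in B.
have {}A : `|F (q + h *: v) - F q - L p (h *: v)| <= e / 3 / `|v| * `|h *: v|.
  apply: A; rewrite addrAC (le_lt_trans (ler_normD _ _))// nh.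
  by rewrite -ltrBrDl.
have {}B := B hd1 d'0.
have : `|L q (h *: v) - L p (h *: v)| <= 2 * (e / 3 / `|v| * (h * `|v|)).
  rewrite mulr_natl mulr2n.
  have -> : L q (h *: v) - L p (h *: v) =
     (F (q + h *: v) - F q - L p (h *: v)) - (F (q + h *: v) - F q - L q (h *: v)).
    by rewrite opprB [RHS]addrC addrA subrK.
  by rewrite (le_trans (ler_normB _ _))// lerD// -nh.
rewrite (blinZ _ _ bq) (blinZ _ _ bp) -scalerBr normrZ gtr0_norm//.
have -> : 2 * (e / 3 / `|v| * (h * `|v|)) = h * (2 * e / 3).
  by field; rewrite gt_eqF.
rewrite ler_pM2l// => /le_lt_trans; apply; lra.
Unshelve. all: by end_near. Qed.

End StrictDifferentiability.

Section StrictCalculus.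
Context {R : realType}.

Lemma sdiff_comp (E G H : normedModType R) (D : set E) (D' : set G)
    (F : E -> G) (K : G -> H) p L M :
  (forall a, D a -> D' (F a)) ->
  sdiff D F p L -> sdiff D' K (F p) M -> sdiff D (K \o F) p (M \o L).
Proof.
move=> DD' dF [_ bM hM]; have [Dp bL hL] := dF; split=> //.
  exact: blin_comp.
move=> e e0.
have [C C0 [d1 d10 lip]] := sdiff_lip dF.
have [_ [K0 K00 hK0]] := bM.
pose e1 := e / (2 * (C + 1)); pose e2 := e / (2 * (K0 + 1)).
have e10 : 0 < e1 by rewrite /e1 divr_gt0// mulr_gt0// ltr_wpDl.
have e20 : 0 < e2 by rewrite /e2 divr_gt0// mulr_gt0// ltr_wpDl.
have [d2 d20 h2] := hM _ e10; have [d3 d30 h3] := hL _ e20.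
have /within_cvgP/(_ _ d20)[d4 d40 h4] := sdiff_cvg dF.
exists (Num.min (Num.min d1 d3) d4); first by rewrite !lt_min d10 d30.
move=> a b Da Db; rewrite !lt_min -!andbA => /and3P[a1 a3 a4] /and3P[b1 b3 b4] /=.
have -> : K (F a) - K (F b) - M (L (a - b)) =
  (K (F a) - K (F b) - M (F a - F b)) + M (F a - F b - L (a - b)).
  by rewrite (blinB (F a - F b) _ bM) addrA subrK.
rewrite (le_trans (ler_normD _ _))//.
have A := h2 _ _ (DD' _ Da) (DD' _ Db) (h4 _ Da a4) (h4 _ Db b4).
have B := hK0 (F a - F b - L (a - b)).
have C' := h3 a b Da Db a3 b3.
have L' := lip a b Da Db a1 b1.
rewrite [e]splitr mulrDl; apply: lerD.
  apply: (le_trans A); apply: (@le_trans _ _ (e1 * (C * `|a - b|))).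
    by rewrite ler_wpM2l// ltW.
  rewrite mulrA ler_wpM2r// /e1 -mulrA ler_pM2l// invfM -mulrA.
  rewrite ger_pMr// mulrC ler_pdivrMr ?ltr_wpDl// mul1r lerDl//.
apply: (le_trans B); apply: (@le_trans _ _ (K0 * (e2 * `|a - b|))).
  by rewrite ler_wpM2l.
rewrite mulrA ler_wpM2r// /e2 mulrCA ler_pM2l// invfM mulrCA ger_pMr//.
by rewrite ler_pdivrMr ?ltr_wpDl// mul1r lerDl.
Qed.

Lemma sdiff_pair (E G H : normedModType R) (D : set E) (F : E -> G) (K : E -> H)
    p L M : sdiff D F p L -> sdiff D K p M ->
  sdiff D (fun a => (F a, K a)) p (fun v => (L v, M v)).
Proof.
move=> [Dp bL hL] [_ bM hM]; split=> //; first exact: blin_pair.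
move=> e e0; have [d1 d10 h1] := hL _ e0; have [d2 d20 h2] := hM _ e0.
exists (Num.min d1 d2); first by rewrite lt_min d10.
move=> a b Da Db; rewrite !lt_min => /andP[a1 a2] /andP[b1 b2].
by rewrite prod_normE/= ge_max h1// h2.
Qed.

(** Stated for an arbitrary bounded bilinear [B], so that multiplication by a scalar function and
    [dot] are both instances. *)
Lemma sdiff_bilin (E G1 G2 G : normedModType R) (B : G1 -> G2 -> G) (K : R)
    (D : set E) (F1 : E -> G1) (F2 : E -> G2) p L1 L2 :
  (forall u v w, B (u + v) w = B u w + B v w) ->
  (forall u v w, B u (v + w) = B u v + B u w) ->
  (forall a u v, B (a *: u) v = a *: B u v) ->
  (forall a u v, B u (a *: v) = a *: B u v) ->
  0 <= K -> (forall u v, `|B u v| <= K * (`|u| * `|v|)) ->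
  sdiff D F1 p L1 -> sdiff D F2 p L2 ->
  sdiff D (fun a => B (F1 a) (F2 a)) p
    (fun v => B (L1 v) (F2 p) + B (F1 p) (L2 v)).
Proof.
move=> BDl BDr BZl BZr K0 hK d1 d2.
have BNl u v : B (- u) v = - B u v by rewrite -scaleN1r BZl scaleN1r.
have BNr u v : B u (- v) = - B u v by rewrite -scaleN1r BZr scaleN1r.
have [Dp bL1 h1] := d1; have [_ bL2 h2] := d2.
have [_ [C1 C10 hC1]] := bL1; have [_ [C2 C20 hC2]] := bL2.
split=> //.
  apply: blin_add.
    apply: (blin_comp bL1 (M := fun u => B u (F2 p))); split=> [a u v|].
      by rewrite BDl BZl.
    exists (K * `|F2 p|); first by rewrite mulr_ge0.
    by move=> v; rewrite mulrAC -mulrA hK.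
  apply: (blin_comp bL2 (M := fun u => B (F1 p) u)); split=> [a u v|].
    by rewrite BDr BZr.
  exists (K * `|F1 p|); first by rewrite mulr_ge0.
  by move=> v; rewrite -mulrA hK.
move=> e e0.
pose S := K * (`|F2 p| + 1 + C1 + (`|F1 p| + 1) + C2) + 1.
have S0 : 0 < S.
  by rewrite ltr_wpDl// mulr_ge0// !addr_ge0.
pose e1 := Num.min 1 (e / S).
have e10 : 0 < e1 by rewrite lt_min ltr01 divr_gt0.
have e11 : e1 <= 1 by rewrite ge_min lexx.
have e1S : e1 * S <= e by rewrite -ler_pdivlMr// ge_min lexx orbT.
have [r1 r10 {}h1] := h1 _ e10; have [r2 r20 {}h2] := h2 _ e10.
have /within_cvgP/(_ _ e10)[r3 r30 h3] := sdiff_cvg d1.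
have /within_cvgP/(_ _ e10)[r4 r40 h4] := sdiff_cvg d2.
exists (Num.min (Num.min r1 r2) (Num.min r3 r4)).
  by rewrite !lt_min r10 r20 r30 r40.
move=> a b Da Db; rewrite !lt_min -!andbA => /and4P[a1 a2 a3 a4] /and4P[b1 b2 b3 b4].
have := h1 a b Da Db a1 b1; have := h2 a b Da Db a2 b2.
have := h3 b Db b3; have := h4 a Da a4.
have := hC1 (a - b); have := hC2 (a - b).
set v := a - b; set l1 := L1 v; set l2 := L2 v; set nv := `|v| => q2 q1 q3 q4 q5 q6.
have -> : B (F1 a) (F2 a) - B (F1 b) (F2 b) - (B l1 (F2 p) + B (F1 p) l2) =
   B (F1 a - F1 b - l1) (F2 a) + B l1 (F2 a - F2 p) +
   (B (F1 b) (F2 a - F2 b - l2) + B (F1 b - F1 p) l2).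
  rewrite !(BDl, BDr, BNl, BNr).
  set x1 := B (F1 a) _; set x2 := B (F1 b) (F2 b); set x3 := B l1 (F2 p).
  set x4 := B (F1 p) l2; set x5 := B (F1 b) (F2 a); set x6 := B l1 (F2 a).
  set x7 := B (F1 b) l2.
  by rewrite !subrKA [x1 - x5 - x3]addrAC -[x5 - x2 - x4]addrA subrKA addrACA opprD.
have F2a : `|F2 a| <= `|F2 p| + 1.
  rewrite -(subrK (F2 p) (F2 a)) (le_trans (ler_normD _ _))// addrC lerD2l.
  by rewrite (le_trans (ltW q3)).
have F1b : `|F1 b| <= `|F1 p| + 1.
  rewrite -(subrK (F1 p) (F1 b)) (le_trans (ler_normD _ _))// addrC lerD2l.
  by rewrite (le_trans (ltW q4)).
have nv0 : 0 <= nv by rewrite normr_ge0.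
have t1 : `|B (F1 a - F1 b - l1) (F2 a)| <= K * ((e1 * nv) * (`|F2 p| + 1)).
  by rewrite (le_trans (hK _ _))// ler_wpM2l// ler_pM.
have t2 : `|B l1 (F2 a - F2 p)| <= K * ((C1 * nv) * e1).
  by rewrite (le_trans (hK _ _))// ler_wpM2l// ler_pM// ltW.
have t3 : `|B (F1 b) (F2 a - F2 b - l2)| <= K * ((`|F1 p| + 1) * (e1 * nv)).
  by rewrite (le_trans (hK _ _))// ler_wpM2l// ler_pM.
have t4 : `|B (F1 b - F1 p) l2| <= K * (e1 * (C2 * nv)).
  by rewrite (le_trans (hK _ _))// ler_wpM2l// ler_pM// ltW.
rewrite (le_trans (ler_normD _ _))//.
rewrite (le_trans (lerD (ler_normD _ _) (ler_normD _ _)))//.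
rewrite (le_trans (lerD (lerD t1 t2) (lerD t3 t4)))//.
apply: (@le_trans _ _ (e1 * S * nv)); last by rewrite ler_wpM2r.
have : 0 <= e1 * nv by rewrite mulr_ge0// ltW.
rewrite /S; lra.
Qed.

Lemma sdiff_scale (E G : normedModType R) (D : set E) (F : E -> R) (K : E -> G)
    p L M : sdiff D F p L -> sdiff D K p M ->
  sdiff D (fun a => F a *: K a) p (fun v => L v *: K p + F p *: M v).
Proof.
move=> dF dK; apply: (@sdiff_bilin _ R G G (fun c u => c *: u) 1) => //.
- by move=> u v w; rewrite scalerDl.
- by move=> u v w; rewrite scalerDr.
- by move=> a u v; rewrite scalerA.
- by move=> a u v; rewrite !scalerA mulrC.
- by move=> u v; rewrite normrZ mul1r.
Qed.

Lemma sdiff_inv (E : normedModType R) (D : set E) (F : E -> R) p (L : E -> R) :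
  F p != 0 -> sdiff D F p L ->
  sdiff D (fun a => (F a)^-1) p (fun v => - (F p) ^- 2 *: L v).
Proof.
move=> Fp0 dF; have [Dp bL h] := dF; split=> //; first exact: blin_scale.
have cF := sdiff_cvg dF.
have cV : (fun a => (F a)^-1) @ within D (nbhs p) --> (F p)^-1 by exact: cvgV.
have [_ [C C0 hC]] := bL.
move=> e e0; set P := (F p)^-1.
pose S := (`|P| + 1) * (`|P| + 1) + C * (`|P| + (`|P| + 1)) + 1.
have P0 : 0 <= `|P| by [].
have S0 : 0 < S by rewrite ltr_wpDl// addr_ge0// mulr_ge0// !addr_ge0.
pose e1 := Num.min 1 (e / S).
have e10 : 0 < e1 by rewrite lt_min ltr01 divr_gt0.
have e11 : e1 <= 1 by rewrite ge_min lexx.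
have e1S : e1 * S <= e by rewrite -ler_pdivlMr// ge_min lexx orbT.
have nFp : 0 < `|F p| by rewrite normr_gt0.
have [r1 r10 h1] := h _ e10.
have /within_cvgP/(_ _ e10)[r2 r20 h2] := cV.
have /within_cvgP/(_ _ nFp)[r3 r30 h3] := cF.
exists (Num.min (Num.min r1 r2) r3); first by rewrite !lt_min r10 r20.
have neq0 a : D a -> `|a - p| < r3 -> F a != 0.
  move=> Da ap; apply/eqP => Fa0; have := h3 a Da ap.
  by rewrite Fa0 sub0r normrN ltxx.
have bd a : D a -> `|a - p| < r2 -> `|(F a)^-1| <= `|P| + 1.
  move=> Da ap; rewrite -(subrK P (F a)^-1) (le_trans (ler_normD _ _))//.
  by rewrite addrC lerD2l (le_trans (ltW (h2 a Da ap))).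
move=> a b Da Db; rewrite !lt_min -!andbA => /and3P[a1 a2 a3] /and3P[b1 b2 b3].
have Fa := neq0 _ Da a3; have Fb := neq0 _ Db b3.
have := h1 a b Da Db a1 b1.
have := h2 a Da a2; have := h2 b Db b2; have := bd a Da a2; have := bd b Db b2.
have := hC (a - b).
set v := a - b; set l := L v; set nv := `|v| => q1 q2 q3 q4 q5 q6.
have -> : (F a)^-1 - (F b)^-1 - - (F p) ^- 2 *: l =
    - ((F a - F b - l) * ((F a)^-1 * (F b)^-1)) +
    - (l * (((F a)^-1 - P) * P + (F a)^-1 * ((F b)^-1 - P))).
  by rewrite /P /GRing.scale/=; field; rewrite Fa Fb Fp0.
have nv0 : 0 <= nv by rewrite normr_ge0.
have t1 : `|(F a - F b - l) * ((F a)^-1 * (F b)^-1)| <=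
    e1 * nv * ((`|P| + 1) * (`|P| + 1)).
  by rewrite !normrM ler_pM// ?mulr_ge0// ler_pM.
have t2 : `|l * (((F a)^-1 - P) * P + (F a)^-1 * ((F b)^-1 - P))| <=
    C * nv * (e1 * `|P| + (`|P| + 1) * e1).
  rewrite normrM ler_pM// (le_trans (ler_normD _ _))// !normrM lerD//.
    by rewrite ler_wpM2r// ltW.
  by rewrite ler_pM// ltW.
rewrite (le_trans (ler_normD _ _))// !normrN (le_trans (lerD t1 t2))//.
apply: (@le_trans _ _ (e1 * S * nv)); last by rewrite ler_wpM2r.
have : 0 <= e1 * nv by rewrite mulr_ge0// ltW.
rewrite /S; lra.
Qed.

End StrictCalculus.

(** * The pairing on row vectors and strict differentiability by coordinates *)

Section Dot.
Context {R : realType} {n : nat}.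
Local Notation V := 'rV[R]_n.
Implicit Types (x y z : V).

Lemma dotC x y : dot x y = dot y x.
Proof. by apply: eq_bigr => i _; rewrite mulrC. Qed.

Lemma dotDl x y z : dot (x + y) z = dot x z + dot y z.
Proof. by rewrite -big_split; apply: eq_bigr => i _; rewrite mxE mulrDl. Qed.

Lemma dotDr x y z : dot x (y + z) = dot x y + dot x z.
Proof. by rewrite dotC dotDl !(dotC x). Qed.

Lemma dotZl a x y : dot (a *: x) y = a * dot x y.
Proof. by rewrite mulr_sumr; apply: eq_bigr => i _; rewrite mxE mulrA. Qed.

Lemma dotZr a x y : dot x (a *: y) = a * dot x y.
Proof. by rewrite dotC dotZl dotC. Qed.

Lemma dotNl x y : dot (- x) y = - dot x y.
Proof. by rewrite -scaleN1r dotZl mulN1r. Qed.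

Lemma dotNr x y : dot x (- y) = - dot x y.
Proof. by rewrite dotC dotNl dotC. Qed.

Lemma dotBl x y z : dot (x - y) z = dot x z - dot y z.
Proof. by rewrite dotDl dotNl. Qed.

Lemma dotBr x y z : dot x (y - z) = dot x y - dot x z.
Proof. by rewrite dotDr dotNr. Qed.

Lemma dot0l x : dot 0 x = 0.
Proof. by rewrite -(scale0r (0 : V)) dotZl mul0r. Qed.

Lemma dot0r x : dot x 0 = 0.
Proof. by rewrite dotC dot0l. Qed.

Lemma dot_basis x i : dot (basis_vec i) x = x 0 i.
Proof.
rewrite /dot (bigD1 i)//= big1 ?addr0 => [|j ji].
  by rewrite mxE !eqxx mul1r.
by rewrite mxE (negbTE ji) andbF mul0r.
Qed.

Lemma basis_decomp x : x = \sum_i x 0 i *: basis_vec i.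
Proof. exact: row_sum_delta. Qed.

Lemma dot_gt0 x : x != 0 -> 0 < dot x x.
Proof.
move=> x0; have : 0 <= dot x x.
  by apply: sumr_ge0 => i _; rewrite -expr2 sqr_ge0.
rewrite le_eqVlt => /orP[/eqP e|//]; case/negP: x0; apply/eqP/rowP => i.
have /psumr_eq0P : forall j : 'I_n, true -> 0 <= x 0 j * x 0 j.
  by move=> j _; rewrite -expr2 sqr_ge0.
move=> /(_ (esym e) i isT)/eqP; rewrite mulf_eq0 orbb => /eqP ->.
by rewrite mxE.
Qed.

Lemma coord_le x i : `|x 0 i| <= `|x|.
Proof.
rewrite [leRHS]/Num.norm/= mx_normrE.
exact: (@le_bigmax _ _ _ 0 (fun ij : 'I_1 * 'I_n => `|x ij.1 ij.2|) (ord0, i)).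
Qed.

Lemma rV_norm_le x (c : R) : 0 <= c -> (forall i, `|x 0 i| <= c) -> `|x| <= c.
Proof.
move=> c0 h; rewrite [leLHS]/Num.norm/= mx_normrE; apply: bigmax_le => //.
by move=> [i j] _ /=; rewrite (ord1 i).
Qed.

Lemma dot_le x y : `|dot x y| <= n%:R * (`|x| * `|y|).
Proof.
rewrite (le_trans (ler_norm_sum _ _ _))//.
rewrite -[X in _ <= X%:R * _]card_ord -sum1_card natr_sum mulr_suml.
by apply: ler_sum => i _; rewrite mul1r normrM ler_pM// coord_le.
Qed.

Lemma blin_dotl x : blin (fun v : V => dot v x).
Proof.
split=> [a u v|]; first by rewrite dotDl dotZl.
by exists (n%:R * `|x|) => [|v]; rewrite ?mulr_ge0// mulrAC -mulrA dot_le.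
Qed.

Lemma blin_coord i : blin (fun v : V => v 0 i).
Proof.
split=> [a u v|]; first by rewrite !mxE.
by exists 1 => // v; rewrite mul1r coord_le.
Qed.

Lemma blin_row (E : normedModType R) (L : 'I_n -> E -> R) :
  (forall i, blin (L i)) -> blin (fun v => \row_i L i v : V).
Proof.
move=> bL; split=> [a u v|]; first by apply/rowP => i; rewrite !mxE (bL i).1.
have [C hC] : exists C : 'I_n -> R, forall i, 0 <= C i /\
    forall v, `|L i v| <= C i * `|v|.
  have /choice[C hC] : forall i, exists c, 0 <= c /\ forall v, `|L i v| <= c * `|v|.
    by move=> i; have [_ [c c0 hc]] := bL i; exists c.
  by exists C.
have C0 : 0 <= \sum_i C i by apply: sumr_ge0 => i _; exact: (hC i).1.
exists (\sum_i C i) => // v; apply: rV_norm_le => [|i]; first by rewrite mulr_ge0.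
rewrite mxE (le_trans ((hC i).2 v))// ler_wpM2r// (bigD1 i)//= lerDl.
by apply: sumr_ge0 => j _; exact: (hC j).1.
Qed.

Lemma sdiff_row (E : normedModType R) (D : set E) (F : 'I_n -> E -> R) p
    (L : 'I_n -> E -> R) : D p -> (forall i, sdiff D (F i) p (L i)) ->
  sdiff D (fun a => \row_i F i a : V) p (fun v => \row_i L i v).
Proof.
move=> Dp dF; split=> //; first by apply: blin_row => i; have [] := dF i.
move=> e e0.
have /choice[d hd] : forall i, exists d, 0 < d /\
    forall a b, D a -> D b -> `|a - p| < d -> `|b - p| < d ->
      `|F i a - F i b - L i (a - b)| <= e * `|a - b|.
  by move=> i; have [_ _ /(_ e e0)[d d0 hd]] := dF i; exists d.
exists (\big[Num.min/1]_i d i).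
  by apply: lt_bigmin => // i _; exact: (hd i).1.
move=> a b Da Db /bigmin_gtP[_ ha] /bigmin_gtP[_ hb].
apply: rV_norm_le => [|i]; first by rewrite mulr_ge0// ltW.
by rewrite !mxE; apply: (hd i).2 => //; [exact: ha|exact: hb].
Qed.

Lemma sdiff_coord (E : normedModType R) (D : set E) (F : E -> V) p L i :
  sdiff D F p L -> sdiff D (fun a => F a 0 i) p (fun v => L v 0 i).
Proof.
move=> dF; apply: (@sdiff_comp _ _ _ _ D setT F (fun v : V => v 0 i) p L
  (fun v : V => v 0 i)) => //.
by apply: sdiff_blin => //; exact: blin_coord.
Qed.

Lemma sdiff_dot (E : normedModType R) (D : set E) (F K : E -> V) p L M :
  sdiff D F p L -> sdiff D K p M ->
  sdiff D (fun a => dot (F a) (K a)) p (fun v => dot (L v) (K p) + dot (F p) (M v)).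
Proof.
apply: (@sdiff_bilin _ E _ _ _ (@dot R n) n%:R) => //.
- by move=> u v w; rewrite dotDl.
- by move=> u v w; rewrite dotDr.
- by move=> a u v; rewrite dotZl.
- by move=> a u v; rewrite dotZr.
- by move=> u v; exact: dot_le.
Qed.

End Dot.

Section MeanValue.
Context {R : realType} {n : nat}.
Local Notation V := 'rV[R]_n.

Lemma partial_MVT (phi : V -> R) (i : 'I_n) z (c : R) :
  (forall s, `|s| <= `|c| -> derivable phi (z + s *: basis_vec i) (basis_vec i)) ->
  exists2 s, `|s| <= `|c| &
    phi (z + c *: basis_vec i) - phi z = c * partial i phi (z + s *: basis_vec i).
Proof.
move=> dphi; set e := basis_vec i in dphi *.
pose g s := phi (z + s *: e).
have dg (s : R) : `|s| <= `|c| -> is_derive s (1 : R) g (partial i phi (z + s *: e)).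
  move=> sc; have E : (fun h : R => h^-1 *: ((g \o shift s) (h *: (1 : R)) - g s)) =
      (fun h : R => h^-1 *: ((phi \o shift (z + s *: e)) (h *: e) - phi (z + s *: e))).
    apply/funext => h /=; rewrite /g /shift/= [h *: 1]mulr1 scalerDl addrCA.
    by [].
  by split; rewrite /derivable /derive /partial /derive E//; exact: dphi.
have cg (a b : R) : (forall s, s \in `[a, b] -> `|s| <= `|c|) ->
    {within `[a, b], continuous g}.
  move=> h; apply: derivable_within_continuous => s sab.
  by have [] := dg s (h s sab).
have [c0|c0] := leP 0 c.
  have [s||s] := @MVT_segment R g (fun s => partial i phi (z + s *: e)) 0 c c0.
  - rewrite in_itv/= => /andP[s0 sc]; apply: dg.
    by rewrite !ger0_norm ?(ltW s0) ?(ltW sc).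
  - by apply: cg => s; rewrite in_itv/= => /andP[s0 sc]; rewrite !ger0_norm.
  - by move=> /[!in_itv]/= /andP[s0 sc] h; exists s; rewrite ?ger0_norm//;
    move: h; rewrite /g scale0r addr0 subr0 mulrC.
have [s||s] := @MVT_segment R g (fun s => partial i phi (z + s *: e)) c 0 (ltW c0).
- rewrite in_itv/= => /andP[s0 sc]; apply: dg.
  by rewrite !ltr0_norm// lerN2 ltW.
- apply: cg => s; rewrite in_itv/= => /andP[s0 sc].
  by rewrite ler0_norm// ltr0_norm// lerN2.
- move=> /[!in_itv]/= /andP[s0 sc] h; exists s.
    by rewrite ler0_norm// ltr0_norm// lerN2.
  by move: h; rewrite /g scale0r addr0 sub0r mulrN mulrC => h; lra.
Qed.

End MeanValue.

(** * Functions of class C^1 on spacetime *)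

Section Spacetime.
Context {R : realType} {n : nat}.
Local Notation V := 'rV[R]_n.
Local Notation E := (R * V)%type.
Implicit Types (F K : R -> V -> R) (t : R) (x : V).

Definition unc F : E -> R := fun p => F p.1 p.2.

(** A limit along [dt_filter t] is unique because the filter is proper: small positive increments
    are admissible even at t = 0. *)
Lemma dt_filter_proper t : 0 <= t -> ProperFilter (dt_filter t).
Proof.
move=> t0; apply: Build_ProperFilter_ex => P.
rewrite /dt_filter/within/= => /nbhs_normP[e /= e0 he].
exists (e / 2); apply: he => /=.
- by rewrite sub0r normrN gtr0_norm ?divr_gt0// ltr_pdivrMr// ltr_pMr// ltr1n.
- by rewrite gt_eqF// divr_gt0.
- by rewrite addr_ge0// divr_ge0// ltW.
Qed.

Lemma dt_filterE t : 0 < t -> forall P : set R, dt_filter t P = (0 : R)^' P.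
Proof.
move=> t0 P; rewrite /dt_filter/within/=; apply/propext; split.
  move=> /nbhs_normP[e /= e0 he]; apply/nbhs_normP.
  exists (Num.min e t) => /=; first by rewrite lt_min e0.
  move=> h /=; rewrite sub0r normrN lt_min => /andP[he' ht] h0.
  apply: he => //=; first by rewrite sub0r normrN.
  by move: ht; rewrite ltr_norml => /andP[th _]; lra.
by apply: filterS => h hP _.
Qed.

(** Valid from [t1 = 0] on: the derivative is required only at interior times, which are positive,
    and there [dt] is the usual two-sided derivative. *)
Lemma dt_MVT F t1 t2 x : C1_spacetime F -> 0 <= t1 -> t1 <= t2 -> x != 0 ->
  exists2 s, t1 <= s <= t2 & F t2 x - F t1 x = dt F s x * (t2 - t1).
Proof.
move=> [C0F dF _ _] t10 t12 x0.
have [s||s] := @MVT_segment R (F ^~ x) (fun s => dt F s x) t1 t2 t12.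
- rewrite in_itv/= => /andP[ts _]; have s0 : 0 < s by exact: le_lt_trans ts.
  have fE : (fun h : R => h^-1 *: (((F ^~ x) \o shift s) (h *: (1:R)) - F s x)) =
      dt_quotient F s x.
    by apply/funext => h /=; rewrite /shift/= [h *: 1]mulr1.
  have dfE : dt_filter s = (0 : R)^' by apply/funext => P; exact: dt_filterE.
  have [+ _] := dF s x (ltW s0) x0.
  by rewrite /dt_derivable dfE -fE => dFs; split=> //; rewrite /dt dfE -fE.
- apply/subspace_continuousP => s. rewrite /= in_itv/= => /andP[ts st].
  have Ds : spacetime (s, x) by split => //=; exact: le_trans ts.
  have /subspace_continuousP/(_ _ Ds) := C0F.
  move=> /within_cvgP h; apply/within_cvgP => e /h[d d0 hd].
  exists d => // a; rewrite /= in_itv/= => /andP[ta _] ad.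
  have := hd (a, x) _ _; apply; first by split=> //=; exact: le_trans ta.
  by rewrite prod_normE/= subrr normr0 gt_max ad.
- by rewrite in_itv/= => sin h; exists s.
Qed.

Definition C1_diff F t x (v : E) : R := v.1 * dt F t x + dot v.2 (grad (F t) x).

Lemma blin_C1_diff F t x : blin (C1_diff F t x).
Proof.
apply: blin_add.
  apply: (blin_comp blin_fst (M := fun c : R => c * dt F t x)); split=> [a u v|].
    by rewrite mulrDl /GRing.scale/= mulrA.
  by exists `|dt F t x| => // v; rewrite normrM mulrC.
exact: (blin_comp blin_snd (blin_dotl (grad (F t) x))).
Qed.

(** Corner of the axis-parallel staircase from [x1] to [x2]. Only partial derivatives are given, so
    increments in space are summed along it. *)
Definition mix_row (x1 x2 : V) (k : nat) : V :=
  \row_i (if (i < k)%N then x2 0 i else x1 0 i).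

Lemma mix_row0 x1 x2 : mix_row x1 x2 0 = x1.
Proof. by apply/rowP => i; rewrite mxE. Qed.

Lemma mix_rown x1 x2 : mix_row x1 x2 n = x2.
Proof. by apply/rowP => i; rewrite mxE ltn_ord. Qed.

Lemma mix_rowS x1 x2 (k : 'I_n) :
  mix_row x1 x2 k.+1 = mix_row x1 x2 k + (x2 0 k - x1 0 k) *: basis_vec k.
Proof.
apply/rowP => i; rewrite !mxE/= ltnS leq_eqVlt.
have [->|ik] := eqVneq i k; first by rewrite !eqxx ltnn/= mulr1 addrC subrK.
by rewrite -val_eqE in ik; rewrite (negbTE ik)/= mulr0 addr0.
Qed.

(** The staircase has to stay near [x], hence off 0. The coordinates of a corner are within [d] of
    those of [x], and the step along the axis is shorter than [2 * d]; hence the factor 3. *)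
Lemma mix_row_near x x1 x2 (k : 'I_n) (s d : R) : 0 < d ->
  `|x1 - x| < d -> `|x2 - x| < d -> `|s| <= `|x2 0 k - x1 0 k| ->
  `|mix_row x1 x2 k + s *: basis_vec k - x| < 3 * d.
Proof.
move=> d0 h1 h2 hs.
have c1 i : `|x1 0 i - x 0 i| < d.
  by rewrite (le_lt_trans _ h1)//; have := coord_le (x1 - x) i; rewrite !mxE.
have c2 i : `|x2 0 i - x 0 i| < d.
  by rewrite (le_lt_trans _ h2)//; have := coord_le (x2 - x) i; rewrite !mxE.
have s2 : `|s| < 2 * d.
  rewrite (le_lt_trans hs)// -(subrKA (x 0 k)) -[x 0 k - _]opprB.
  by rewrite (le_lt_trans (ler_normB _ _))// mulr_natl mulr2n ltrD.
apply: (@le_lt_trans _ _ (Num.max `|x1 - x| `|x2 - x| + `|s|)).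
  apply: rV_norm_le => [|i]; first by rewrite addr_ge0// le_max normr_ge0.
  rewrite !mxE/= addrAC (le_trans (ler_normD _ _))// lerD//.
    rewrite le_max; case: ifP => _; apply/orP; [right|left].
      by have := coord_le (x2 - x) i; rewrite !mxE.
    by have := coord_le (x1 - x) i; rewrite !mxE.
  by case: eqP => _; rewrite ?mulr1 ?mulr0 ?normr0.
have : Num.max `|x1 - x| `|x2 - x| < d by rewrite gt_max h1.
lra.
Qed.

(** The increment splits into one change of time, at [x1], and [n] changes of a coordinate, at time
    [t2]. On each piece the mean value theorem and the continuity of the derivative at [(t, x)]
    leave an error with the share [e / (n + 1)]. *)
Lemma C1_sdiff F t x : C1_spacetime F -> 0 <= t -> x != 0 ->
  sdiff spacetime (unc F) (t, x) (C1_diff F t x).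
Proof.
move=> C1F t0 x0; have [C0F dF C0dt C0dx] := C1F.
have Dtx : spacetime (t, x) by split.
split=> //; first exact: blin_C1_diff.
move=> e e0; have n1 : 0 < (n.+1)%:R :> R by rewrite ltr0n.
pose e1 := e / n.+1%:R; have e10 : 0 < e1 by rewrite divr_gt0.
have /subspace_continuousP/(_ _ Dtx)/within_cvgP/(_ _ e10)[d0 d00 h0] := C0dt.
have /choice[d hd] : forall i, exists d, 0 < d /\ forall a : E, spacetime a ->
    `|a - (t, x)| < d -> `|dx i F a.1 a.2 - dx i F t x| < e1.
  move=> i.
  have /subspace_continuousP/(_ _ Dtx)/within_cvgP/(_ _ e10)[d' d'0 h'] := C0dx i.
  by exists d'.
(* The bound by the norm of [x] keeps the staircase away from 0; the radius [r / 3] makes up for the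
   factor 3 in [mix_row_near]. *)
pose r := Num.min (Num.min d0 `|x|) (\big[Num.min/1]_i d i).
have r0 : 0 < r.
  rewrite /r !lt_min d00 normr_gt0 x0/=; apply: lt_bigmin => // i _.
  exact: (hd i).1.
have r30 : 0 < r / 3 by rewrite divr_gt0.
have rE : 3 * (r / 3) = r by field.
exists (r / 3) => //.
have nz y : `|y - x| < r -> y != 0.
  apply: contraTneq => ->; rewrite sub0r normrN -leNgt /r !ge_min lexx.
  by rewrite orbT.
move=> [t1 x1] [t2 x2] [/= t10 x10] [/= t20 x20].
rewrite !prod_normE/= !gt_max => /andP[tt1 xx1] /andP[tt2 xx2].
have small (u : R) : u < r / 3 -> u < r by lra.
rewrite /C1_diff/= dotBl.
set a := dt F t x; set p := grad (F t) x; set N := Num.max _ _.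
have time : `|F t1 x1 - F t2 x1 - (t1 - t2) * a| <= e1 * `|t1 - t2|.
  wlog le12 : t1 t2 t10 t20 tt1 tt2 {N} / t2 <= t1.
    move=> h; have [le|/ltW le] := leP t2 t1; first exact: h.
    have -> : F t1 x1 - F t2 x1 - (t1 - t2) * a =
        - (F t2 x1 - F t1 x1 - (t2 - t1) * a) by ring.
    by rewrite normrN (distrC t1 t2); exact: h.
  have [s /andP[s1 s2] ->] := dt_MVT C1F t20 le12 x10.
  rewrite mulrC -mulrBr normrM mulrC ler_wpM2r//.
  apply/ltW/(h0 (s, x1)); first by split => //=; exact: le_trans s1.
  rewrite prod_normE/= gt_max.
  move: tt1 tt2; rewrite !ltr_norml => /andP[A1 A2] /andP[B1 B2].
  have rd0 : r <= d0 by rewrite /r !ge_min lexx.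
  apply/andP; split; first by apply/andP; split; lra.
  by apply: lt_le_trans rd0; exact: small.
have space : `|F t2 x1 - F t2 x2 - (dot x1 p - dot x2 p)| <= n%:R * (e1 * `|x1 - x2|).
  have -> : F t2 x1 - F t2 x2 - (dot x1 p - dot x2 p) =
      - \sum_(k < n) (F t2 (mix_row x1 x2 k.+1) - F t2 (mix_row x1 x2 k)
                     - (x2 0 k - x1 0 k) * p 0 k).
    rewrite sumrB -(big_mkord xpredT
      (fun k => F t2 (mix_row x1 x2 k.+1) - F t2 (mix_row x1 x2 k))).
    rewrite telescope_sumr// mix_row0 mix_rown -dotBl.
    have -> : \sum_(i < n) (x2 0 i - x1 0 i) * p 0 i = dot (x2 - x1) p.
      by apply: eq_bigr => i _; rewrite !mxE.
    by rewrite !dotBl; ring.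
  rewrite normrN (le_trans (ler_norm_sum _ _ _))//.
  rewrite -[X in _ <= X%:R * _]card_ord -sum1_card natr_sum mulr_suml.
  apply: ler_sum => k _; rewrite mul1r mix_rowS.
  have near s : `|s| <= `|x2 0 k - x1 0 k| ->
      `|mix_row x1 x2 k + s *: basis_vec k - x| < r.
    by move=> hs; rewrite -rE; exact: mix_row_near.
  have [s sc ->] := @partial_MVT _ _ (F t2) k (mix_row x1 x2 k) (x2 0 k - x1 0 k)
    (fun s hs => (dF t2 _ t20 (nz _ (near s hs))).2 k).
  rewrite -mulrBr normrM mulrC ler_pM//; last first.
    by have := coord_le (x1 - x2) k; rewrite !mxE distrC.
  rewrite /p mxE; apply/ltW/((hd k).2 (t2, _)) => /=.
    by split => //=; exact/nz/near.
  rewrite prod_normE/= gt_max; apply/andP; split.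
    apply: (lt_le_trans tt2); rewrite ler_pdivrMr// (@le_trans _ _ (d k))//.
      by rewrite /r ge_min; apply/orP; right; exact: bigmin_le.
    by rewrite ler_peMr// ?(ltW (hd k).1)// ler1n.
  apply: (lt_le_trans (near s sc)); rewrite /r ge_min; apply/orP; right.
  exact: bigmin_le.
rewrite /unc/=.
have -> : F t1 x1 - F t2 x2 - ((t1 - t2) * a + (dot x1 p - dot x2 p)) =
  (F t1 x1 - F t2 x1 - (t1 - t2) * a) + (F t2 x1 - F t2 x2 - (dot x1 p - dot x2 p)).
  by ring.
rewrite (le_trans (ler_normD _ _))// (le_trans (lerD time space))//.
have tN : `|t1 - t2| <= N by rewrite /N le_max lexx.
have xN : `|x1 - x2| <= N by rewrite /N le_max lexx orbT.
have -> : e = e1 * n.+1%:R by rewrite divfK ?gt_eqF.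
rewrite -natr1 mulrDr mulr1 mulrDl addrC lerD//.
  by rewrite mulrCA mulrA ler_wpM2l// mulr_ge0// ltW.
by rewrite ler_wpM2l// ltW.
Qed.

End Spacetime.

(** * From strict derivatives back to partial derivatives; constant families *)

Section SpacetimeConverse.
Context {R : realType} {n : nat}.
Local Notation V := 'rV[R]_n.
Local Notation E := (R * V)%type.
Implicit Types (F K : R -> V -> R) (t : R) (x : V).

Lemma spacetime_shift_time (q : E) : spacetime q ->
  \forall h \near (0 : R)^'+, spacetime (q + h *: ((1 : R), (0 : V))).
Proof.
move=> [q1 q2]; near=> h; split => /=; last by rewrite scaler0 addr0.
by rewrite addr_ge0// [_ *: _]mulr1.
Unshelve. all: by end_near. Qed.

Lemma spacetime_shift_space (q : E) (v : V) : spacetime q ->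
  \forall h \near (0 : R)^'+, spacetime (q + h *: ((0 : R), v)).
Proof.
move=> [q1 q2]; have [->|v0] := eqVneq v 0.
  near=> h; split => /=; first by rewrite scaler0 addr0.
  by rewrite scaler0 addr0.
near=> h; split => /=; first by rewrite scaler0 addr0.
have hv : h * `|v| < `|q.2|.
  rewrite -ltr_pdivlMr ?normr_gt0//; near: h; apply: nbhs_right_lt.
  by rewrite divr_gt0 ?normr_gt0.
apply: contraTneq hv => /eqP; rewrite addr_eq0 => /eqP ->.
have h0 : 0 < h by near: h; exact: nbhs_right_gt.
by rewrite normrN normrZ gtr0_norm// ltxx.
Unshelve. all: by end_near. Qed.

Section AtPoint.
Variables (F : R -> V -> R) (t : R) (x : V) (L : E -> R).
Hypothesis dF : sdiff spacetime (unc F) (t, x) L.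

Lemma sdiff_dt_cvg : dt_quotient F t x h @[h --> dt_filter t] --> L (1, 0).
Proof.
have [[/= t0 x0] bL h] := dF.
apply/cvgrPdist_le => e e0; have [d d0 hd] := h e e0.
rewrite /dt_filter; apply/nbhs_normP; exists d => //= s /=.
rewrite sub0r normrN => sd s0 st.
have := hd (s + t, x) (t, x); rewrite !prod_normE/= !addrK !subrr !normr0.
rewrite !max_l// => /(_ _ _ sd d0).
have -> : (s + t, x) - (t, x) = s *: ((1 : R), (0 : V)).
  by congr pair; rewrite /= ?addrK ?subrr ?scaler0// [RHS]mulr1.
rewrite (blinZ _ _ bL) /unc/= => hs; rewrite distrC /dt_quotient.
have {}hs := hs (conj st x0) (conj t0 x0).
have s0' : 0 < `|s| by rewrite normr_gt0.
rewrite -(ler_pM2l s0') -normrM mulrBr mulrA divff// mul1r.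
by rewrite mulrC in hs; rewrite (mulrC `|s|) mulrC.
Qed.

Lemma sdiff_dt_derivable : dt_derivable F t x.
Proof. by apply/cvg_ex; exists (L (1, 0)); exact: sdiff_dt_cvg. Qed.

Lemma sdiff_dt : dt F t x = L (1, 0).
Proof.
have [[/= t0 x0] _ _] := dF.
have PF := dt_filter_proper t0.
by apply/cvg_lim => //; exact: sdiff_dt_cvg.
Qed.

Lemma sdiff_derive_cvg (v : V) :
  h^-1 *: ((F t \o shift x) (h *: v) - F t x) @[h --> (0 : R)^'] --> L (0, v).
Proof.
have [[/= t0 x0] bL h] := dF.
apply/cvgrPdist_le => e e0.
have e1 : 0 < e / (`|v| + 1) by rewrite divr_gt0// ltr_wpDl.
have [d d0 hd] := h _ e1.
have r0 : 0 < Num.min d `|x| / (`|v| + 1).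
  by rewrite divr_gt0 ?ltr_wpDl// lt_min d0 normr_gt0.
rewrite /dnbhs/within/=; apply/nbhs_normP; eexists; first exact: r0.
move=> s /=; rewrite sub0r normrN => sd s0.
rewrite ltr_pdivlMr ?ltr_wpDl// in sd.
have sv : `|s *: v| < Num.min d `|x|.
  by rewrite normrZ (le_lt_trans _ sd)// ler_wpM2l// lerDl.
move: sv; rewrite lt_min => /andP[svd svx].
have Dy : spacetime (t, s *: v + x).
  split => //=; apply: contraTneq svx => /eqP; rewrite addr_eq0 => /eqP ->.
  by rewrite normrN ltxx.
have := hd (t, s *: v + x) (t, x) Dy (conj t0 x0).
rewrite !prod_normE/= !addrK !subrr !normr0 !max_r// => /(_ svd d0).
have -> : (t, s *: v + x) - (t, x) = s *: ((0 : R), v).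
  by congr pair; rewrite /= ?addrK ?subrr ?scaler0.
rewrite (blinZ _ _ bL) /unc/= => hs; rewrite distrC.
have s0' : 0 < `|s| by rewrite normr_gt0.
rewrite -(ler_pM2l s0') -normrM mulrBr mulrA divff// mul1r (le_trans hs)//.
rewrite normrZ [leRHS]mulrC -!mulrA ler_pM2l// mulrCA ger_pMr//.
by rewrite mulrC ler_pdivrMr ?ltr_wpDl// mul1r lerDl.
Qed.

Lemma sdiff_derivable (v : V) : derivable (F t) x v.
Proof. by apply/cvg_ex; exists (L (0, v)); exact: sdiff_derive_cvg. Qed.

Lemma sdiff_partial i : partial i (F t) x = L (0, basis_vec i).
Proof. by apply/cvg_lim => //; exact: sdiff_derive_cvg. Qed.

Lemma sdiff_grad v : dot v (grad (F t) x) = L (0, v).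
Proof.
have [_ bL _] := dF.
have bL2 : blin (fun v : V => L (0, v)).
  apply: (blin_comp (L := fun v : V => (0 : R, v)) _ bL).
  apply: (blin_pair (L := fun=> 0)); first exact: blin_cst0.
  by split=> //; exists 1 => // u; rewrite mul1r.
rewrite [in RHS](basis_decomp v).
have -> : L (0, \sum_i v 0 i *: basis_vec i) = \sum_i L (0, v 0 i *: basis_vec i).
  apply: (big_morph (fun u : V => L (0, u))); last exact: (blin0 bL2).
  by move=> u w; rewrite (blinD u w bL2).
by apply: eq_bigr => i _; rewrite (blinZ _ _ bL2) mxE sdiff_partial.
Qed.

Lemma sdiff_C1_diff v : L v = C1_diff F t x v.
Proof.
have [_ bL _] := dF; case: v => a v; rewrite /C1_diff/= sdiff_grad sdiff_dt.
rewrite -[a * _](blinZ a ((1, 0) : E) bL) -(blinD _ _ bL); congr L.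
congr pair; rewrite /= ?scaler0 ?add0r//.
by rewrite addr0 [_ *: _]mulr1.
Qed.

End AtPoint.

(** From every point of [spacetime], small positive steps forward in time or in any spatial
    direction stay inside, so [sdiff_continuous] supplies the continuity of the derivatives. *)
Lemma sdiff_C1 F : (forall p, spacetime p -> exists L, sdiff spacetime (unc F) p L) ->
  C1_spacetime F.
Proof.
move=> dF; have {}dF p : spacetime p ->
    sdiff spacetime (unc F) p (C1_diff F p.1 p.2).
  move=> Dp; have [L dL] := dF p Dp; apply: eq_sdiffr (dL) => v.
  by apply: sdiff_C1_diff; case: p Dp dL.
have cont G : (forall p, spacetime p -> unc G @ within spacetime (nbhs p) --> unc G p) ->
    C0_spacetime G.
  by move=> h; apply/subspace_continuousP => p; exact: h.
split.
- by apply: cont => p /dF/sdiff_cvg.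
- move=> t x t0 x0; have Dp : spacetime (t, x) by [].
  split; first exact: sdiff_dt_derivable (dF _ Dp).
  by move=> i; exact: sdiff_derivable (dF _ Dp) _.
- apply: cont => p Dp.
  have -> : unc (dt F) = (fun q => C1_diff F q.1 q.2 (1, 0)).
    by apply/funext => q; rewrite /C1_diff/= mul1r dot0l addr0.
  exact: (sdiff_continuous dF Dp (spacetime_shift_time)).
- move=> i; apply: cont => p Dp.
  have -> : unc (dx i F) = (fun q => C1_diff F q.1 q.2 (0, basis_vec i)).
    by apply/funext => q; rewrite /C1_diff/= mul0r add0r dot_basis mxE.
  by apply: (sdiff_continuous dF Dp) => q; exact: spacetime_shift_space.
Qed.

(** [F] and [K] may differ off [spacetime], so they cannot be rewritten into each other under the
    derivatives; [sdiff] sees only the values on [spacetime]. *)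
Lemma eq_C1_spacetime F K : (forall t x, 0 <= t -> x != 0 -> F t x = K t x) ->
  C1_spacetime F -> C1_spacetime K.
Proof.
move=> FK C1F; apply: sdiff_C1 => -[t x] [/= t0 x0].
exists (C1_diff F t x); apply: (eq_sdiff _ (C1_sdiff C1F t0 x0)).
by move=> [s y] [/= s0 y0]; exact: FK.
Qed.

Lemma C1_slice F t : C1_spacetime F -> 0 <= t -> C1_off0 (F t).
Proof.
move=> [C0F dF _ C0dx] t0.
have slice K : C0_spacetime K -> forall x, x != 0 -> {for x, continuous (K t)}.
  move=> C0K x x0; have Dp : spacetime (t, x) by [].
  have /subspace_continuousP/(_ _ Dp)/within_cvgP h := C0K.
  apply/(@nbhs_cvgP R V) => e /h[d d0 hd].
  have r0 : 0 < Num.min d `|x| by rewrite lt_min d0 normr_gt0.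
  exists (Num.min d `|x|) => // y.
  rewrite lt_min => /andP[yd yx]; have y0 : y != 0.
    by apply/eqP => y0; move: yx; rewrite y0 sub0r normrN ltxx.
  apply: (hd (t, y)) => //.
  by rewrite prod_normE/= subrr normr0 gt_max d0.
move=> x x0; split; first exact: (slice F C0F).
by move=> i; split; [exact: (dF t x t0 x0).2|exact: (slice (dx i F) (C0dx i))].
Qed.

Lemma C2_slice F t : C2_spacetime F -> 0 <= t -> C2_off0 (F t).
Proof.
move=> [C1F _ C1dx] t0; split; first exact: C1_slice.
by move=> i; exact: (C1_slice (C1dx i)).
Qed.

Lemma dt_cst (phi : V -> R) t x : 0 <= t -> dt (fun=> phi) t x = 0.
Proof.
move=> t0; have PF := dt_filter_proper t0; apply/cvg_lim => //.
have -> : dt_quotient (fun=> phi) t x = cst 0.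
  by apply/funext => h; rewrite /dt_quotient subrr mulr0.
exact: cvg_cst.
Qed.

(** Viewing a single function as a constant family makes the theory of families yield its
    directional derivatives, the continuity of its intercept and, later, the regularity of the polar
    of [f]. *)
Lemma C1_static (phi : V -> R) : C1_off0 phi -> C1_spacetime (fun=> phi).
Proof.
move=> C1p.
have cont (K : V -> R) : (forall x, x != 0 -> {for x, continuous K}) ->
    C0_spacetime (fun=> K).
  move=> cK; apply/subspace_continuousP => -[t x] [/= t0 x0].
  apply/within_cvgP => e e0.
  have /(@nbhs_cvgP R V)/(_ e e0)[d d0 hd] := cK x x0.
  exists d => // -[s y] _; rewrite prod_normE/= gt_max => /andP[_ yx].
  exact: hd.
split.
- by apply: cont => x /C1p[].
- move=> t x t0 x0; split; last by move=> i; have [_ /(_ i)[]] := C1p x x0.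
  apply/cvg_ex; exists 0.
  have -> : dt_quotient (fun=> phi) t x = cst 0.
    by apply/funext => h; rewrite /dt_quotient subrr mulr0.
  exact: cvg_cst.
- apply/subspace_continuousP => -[t x] [/= t0 x0].
  apply/within_cvgP => e e0; exists 1 => // -[s y] [/= s0 y0] _.
  change (`|dt (fun=> phi) s y - dt (fun=> phi) t x| < e).
  by rewrite !dt_cst// subrr normr0.
- move=> i; apply: cont => x x0; by have [_ /(_ i)[]] := C1p x x0.
Qed.

End SpacetimeConverse.

(** * Tangents of convex functions *)

Section ConvexFunctions.
Context {R : realType} {n : nat}.
Local Notation V := 'rV[R]_n.
Implicit Types (phi psi : V -> R) (x y z v : V).

Definition cvx phi : Prop := forall x y (t : R), 0 <= t <= 1 ->
  phi (t *: x + (1 - t) *: y) <= t * phi x + (1 - t) * phi y.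

Definition scvx phi : Prop := forall x y (t : R), x != y -> 0 < t < 1 ->
  phi (t *: x + (1 - t) *: y) < t * phi x + (1 - t) * phi y.

Definition nonlin phi : Prop := forall x, x != 0 ->
  ~ exists a b : R, [/\ 0 <= a, 0 < b &
      forall t : R, 0 <= t -> a * t - b <= phi (t *: x) <= a * t].

(* Minus the value at 0 of the tangent to the graph at x. *)
Definition itc phi x : R := dot x (grad phi x) - phi x.

Lemma scvx_cvx phi : scvx phi -> cvx phi.
Proof.
move=> sc x y t /andP[t0 t1].
have [->|xy] := eqVneq x y; first by rewrite -scalerDl -mulrDl subrKC scale1r mul1r.
have [->|tn0] := eqVneq t 0; first by rewrite scale0r mul0r !add0r subr0 scale1r mul1r.
have [->|tn1] := eqVneq t 1; first by rewrite subrr !scale0r !mul0r !addr0 scale1r mul1r.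
by apply/ltW/sc => //; rewrite !lt_neqAle eq_sym tn0 t0 tn1.
Qed.

Lemma derive_cvg phi x v : C1_off0 phi -> x != 0 ->
  h^-1 *: ((phi \o shift x) (h *: v) - phi x) @[h --> (0 : R)^'] -->
  dot v (grad phi x).
Proof.
move=> C1p x0; have := C1_sdiff (C1_static C1p) (lexx 0) x0.
move=> /sdiff_derive_cvg/(_ v); congr (_ --> _).
by rewrite /C1_diff/= mul0r add0r.
Qed.

(** Convexity bounds the difference quotients at [x] towards [z] by [phi z - phi x]; pass to the
    limit. With equality at [z = x], this identifies [itc phi x] as the Legendre transform of [phi]
    at [grad phi x]. *)
Lemma tangent_le phi x z : cvx phi -> C1_off0 phi -> x != 0 ->
  dot z (grad phi x) - phi z <= itc phi x.
Proof.
move=> cp C1p x0; have := derive_cvg (v := z - x) C1p x0.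
move=> /cvg_dnbhs_at_right/cvgr_to_le H.
suff : dot (z - x) (grad phi x) <= phi z - phi x by rewrite dotBl /itc; lra.
apply: H; near=> h.
have h0 : 0 < h by near: h; exact: nbhs_right_gt.
have h1 : h <= 1 by near: h; exact: nbhs_right_ltW.
have := cp z x h; rewrite (ltW h0) h1 => /(_ isT).
have -> : h *: z + (1 - h) *: x = h *: (z - x) + x.
  by rewrite scalerBl scale1r scalerBr addrCA addrC.
rewrite /shift/= => hz; rewrite -(ler_pM2l h0) [_ *: _]/(h^-1 * _).
rewrite mulrA divff ?gt_eqF// mul1r; lra.
Unshelve. all: by end_near. Qed.

Lemma tangent_lt phi x z : scvx phi -> C1_off0 phi -> x != 0 -> z != x ->
  dot z (grad phi x) - phi z < itc phi x.
Proof.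
move=> sp C1p x0 zx.
have h : 0 < (2^-1 : R) < 1 by lra.
have := sp z x 2^-1 zx h.
have := tangent_le (2^-1 *: z + (1 - 2^-1) *: x) (scvx_cvx sp) C1p x0.
rewrite dotDl !dotZl /itc; lra.
Qed.

(** Adding the tangent inequalities at [x] and [l *: x], each evaluated at the other point, shows
    that slopes increase along the ray; the tangent at [x], evaluated at [l *: x], then compares the
    intercepts. *)
Lemma itc_ray phi x (l : R) : cvx phi -> C1_off0 phi -> x != 0 -> 0 < l <= 1 ->
  itc phi (l *: x) <= itc phi x.
Proof.
move=> cp C1p x0 /andP[l0 l1].
have [->|ln1] := eqVneq l 1; first by rewrite scale1r.
have y0 : l *: x != 0 by rewrite scaler_eq0 negb_or gt_eqF.
have := tangent_le (l *: x) cp C1p x0; have := tangent_le x cp C1p y0.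
rewrite /itc !dotZl; set a := dot x (grad phi x); set b := dot x _.
set p := phi x; set q := phi _ => A B.
have l1' : 0 < 1 - l by rewrite subr_gt0 lt_neqAle ln1.
have ab : 0 <= a - b.
  by rewrite -(pmulr_rge0 _ l1') mulrBr !mulrBl; lra.
have := mulr_ge0 (ltW l0) ab; rewrite mulrBr; lra.
Qed.

Lemma ray_ge phi x (l : R) : cvx phi -> phi 0 = 0 -> 0 <= l <= 1 ->
  phi (l *: x) <= l * phi x.
Proof.
by move=> cp p0 l01; have := cp x 0 l l01; rewrite scaler0 p0 mulr0 !addr0.
Qed.

(** If the intercepts on the ray were bounded by [M], the tangent slopes would have a finite
    supremum [a], and the function would lie between [a * t - M] and [a * t]. *)
Lemma nonlin_itc phi x (M : R) : cvx phi -> C1_off0 phi -> phi 0 = 0 ->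
  (forall x, 0 <= phi x) -> nonlin phi -> x != 0 ->
  exists2 t : R, 0 < t & M < itc phi (t *: x).
Proof.
move=> cp C1p p0 pp np x0; apply: contrapT => nM.
have {}nM t : 0 < t -> itc phi (t *: x) <= M.
  by move=> t0; rewrite leNgt; apply/negP => h; apply: nM; exists t.
apply: (np x x0); pose A := [set dot x (grad phi (t *: x)) | t in [set t : R | 0 < t]].
have tx0 t : 0 < t -> t *: x != 0 by move=> t0; rewrite scaler_eq0 negb_or gt_eqF.
have slope s t : 0 < t -> s * dot x (grad phi (t *: x)) - phi (s *: x) <= M.
  move=> t0; rewrite -dotZl.
  by apply: le_trans (nM t t0); apply: tangent_le => //; exact: tx0.
have A0 : A !=set0 by exists (dot x (grad phi (1 *: x))), 1 => //=; exact: ltr01.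
have hA : has_sup A.
  split=> //; exists (phi x + M) => _ [t t0 <-].
  by have := slope 1 t t0; rewrite mul1r scale1r; lra.
have itc_ge0 t : 0 < t -> 0 <= itc phi (t *: x).
  by move=> t0; have := tangent_le 0 cp C1p (tx0 t t0); rewrite dot0l p0 subr0.
have M0 : 0 <= M by exact: le_trans (itc_ge0 1 ltr01) (nM 1 ltr01).
(* [M + 1] in place of [M], since [nonlin] wants a positive [b] and [M] may be 0. *)
exists (sup A), (M + 1); split.
- have := itc_ge0 1 ltr01; rewrite /itc scale1r => h.
  have : dot x (grad phi (1 *: x)) <= sup A.
    by apply: ub_le_sup => //; [exact: hA.2|exists 1 => //=; exact: ltr01].
  by rewrite scale1r; have := pp x; lra.
- lra.
- move=> t; rewrite le_eqVlt => /orP[/eqP<-|t0].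
    by rewrite mulr0 scale0r p0 lexx andbT; lra.
  apply/andP; split; last first.
    have := itc_ge0 t t0; rewrite /itc dotZl.
    have : dot x (grad phi (t *: x)) <= sup A.
      by apply: ub_le_sup => //; [exact: hA.2|exists t].
    by rewrite -(ler_pM2l t0) (mulrC _ (sup A)); lra.
  suff : sup A <= (phi (t *: x) + M) / t.
    by rewrite ler_pdivlMr//; lra.
  apply: ge_sup => // _ [s s0 <-]; rewrite ler_pdivlMr// mulrC.
  by have := slope t s s0; lra.
Qed.

(** A function between [a * t - b] and [a * t] has tangent slopes at most [a] on the ray, hence
    intercepts at most [b]. *)
Lemma itc_nonlin phi : cvx phi -> C1_off0 phi ->
  (forall x (M : R), x != 0 -> exists2 t : R, 0 < t & M < itc phi (t *: x)) ->
  nonlin phi.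
Proof.
move=> cp C1p h x x0 [a [b [a0 b0 ab]]].
have [t t0 bt] := h x b x0.
have tx0 : t *: x != 0 by rewrite scaler_eq0 negb_or gt_eqF.
set m := dot x (grad phi (t *: x)).
have ma : m <= a.
  apply/ler_addgt0Pr => e e0; set s := itc phi (t *: x) in bt.
  have s0 : 0 < s by exact: lt_trans bt.
  have := tangent_le ((s / e) *: x) cp C1p tx0; rewrite dotZl -/m -/s.
  have se : 0 < s / e by exact: divr_gt0.
  have /andP[_] := ab _ (ltW se).
  move=> A B; have {A B} : s / e * m <= s / e * a + s / e * e.
    by rewrite divfK ?gt_eqF//; lra.
  by rewrite -mulrDr ler_pM2l.
have /andP[A _] := ab t (ltW t0).
move: bt; rewrite /itc dotZl -/m => bt.
by have := ler_wpM2l (ltW t0) ma; lra.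
Qed.

End ConvexFunctions.

(** * Compactness of spheres and continuity of the intercept *)

Section Compactness.
Context {R : realType} {n : nat}.
Local Notation V := 'rV[R]_n.

Lemma cvg_rsum (T : Type) (F : set_system T) (FF : Filter F) (f : 'I_n -> T -> R)
    (l : 'I_n -> R) : (forall i, f i @ F --> l i) ->
  (fun a => \sum_i f i a) @ F --> \sum_i l i.
Proof.
move=> h; elim: (index_enum _) => [|i s IH].
  by under eq_fun do rewrite big_nil; rewrite big_nil; exact: cvg_cst.
under eq_fun do rewrite big_cons; rewrite big_cons; exact: cvgD.
Qed.

Lemma compact_sphere (r : R) : compact [set y : V | `|y| = r].
Proof.
apply: bounded_closed_compact.
  by exists r; split; [exact: num_real|move=> M rM y /= ->; exact: ltW].
exact: (closed_comp (fun y _ => @norm_continuous _ _ y) (@closed_eq _ r)).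
Qed.

Lemma compact_pos_lbound (K : set V) (f : V -> R) : compact K ->
  (forall x, K x -> f @ nbhs x --> f x) -> (forall x, K x -> 0 < f x) ->
  exists2 m, 0 < m & forall x, K x -> m <= f x.
Proof.
move=> cK cf f0; have [K0|/set0P K0] := eqVneq K set0.
  by exists 1 => // x; rewrite K0.
have [|c] := EVT_min_rV K0 cK (f := f).
  by apply/subspace_continuousP => x Kx; apply: cvg_within_filter; exact: cf.
rewrite inE => Kc h; exists (f c); first exact: f0.
by move=> x Kx; apply: h; rewrite inE.
Qed.

Lemma compact_ubound (K : set V) (f : V -> R) : compact K ->
  (forall x, K x -> f @ nbhs x --> f x) ->
  exists2 M, 0 < M & forall x, K x -> f x <= M.
Proof.
move=> cK cf; have [K0|/set0P K0] := eqVneq K set0.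
  by exists 1 => // x; rewrite K0.
have [|c] := EVT_max_rV K0 cK (f := f).
  by apply/subspace_continuousP => x Kx; apply: cvg_within_filter; exact: cf.
rewrite inE => Kc h; exists (`|f c| + 1); first by rewrite ltr_wpDl.
move=> x Kx; rewrite (le_trans (h x _)) ?inE//.
by rewrite (le_trans (ler_norm _))// lerDl.
Qed.

Lemma itc_spacetime_cvg (H : R -> V -> R) (p : R * V) : C1_spacetime H ->
  spacetime p ->
  (fun q => itc (H q.1) q.2) @ within spacetime (nbhs p) --> itc (H p.1) p.2.
Proof.
move=> [C0H _ _ C0dx] Dp; apply: cvgB; last first.
  by have /subspace_continuousP/(_ _ Dp) := C0H.
apply: cvg_rsum => i; apply: cvgM.
  apply: cvg_within_filter.
  apply: (@continuous_comp _ _ _ (snd : R * V -> V) (fun v : V => v 0 i) p).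
    exact: cvg_snd.
  exact: coord_continuous.
under eq_fun do rewrite mxE; rewrite mxE.
by have /subspace_continuousP/(_ _ Dp) := C0dx i.
Qed.

Lemma C1_off0_cvg (phi : V -> R) (x : V) : C1_off0 phi -> x != 0 ->
  phi @ nbhs x --> phi x.
Proof. by move=> C1p /C1p[]. Qed.

Lemma itc_cvg (phi : V -> R) (x : V) : C1_off0 phi -> x != 0 ->
  itc phi @ nbhs x --> itc phi x.
Proof.
move=> C1p x0; have Dp : spacetime (0 : R, x) by split.
have /within_cvgP h := itc_spacetime_cvg (C1_static C1p) Dp.
apply/(@nbhs_cvgP R V) => e /h[d d0 hd].
exists (Num.min d `|x|); first by rewrite lt_min d0 normr_gt0.
move=> y; rewrite lt_min => /andP[yd yx].
have y0 : y != 0 by apply/eqP => y0; move: yx; rewrite y0 sub0r normrN ltxx.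
apply: (hd (0, y)) => //.
by rewrite prod_normE/= subrr normr0 gt_max d0.
Qed.

End Compactness.

(** * Growth of the intercept and existence of contact points *)

Section Good.
Context {R : realType} {n : nat}.
Local Notation V := 'rV[R]_n.
Implicit Types (phi psi : V -> R) (x y z v : V).

Definition good phi : Prop :=
  [/\ phi 0 = 0, forall x, 0 <= phi x, scvx phi, C1_off0 phi & nonlin phi].

Lemma sphere_neq0 (r : R) x : 0 < r -> `|x| = r -> x != 0.
Proof. by move=> r0 xr; rewrite -normr_gt0 xr. Qed.

Lemma good_gt0 phi x : good phi -> x != 0 -> 0 < phi x.
Proof.
move=> [p0 pp sp _ _] x0; have := sp x 0 2^-1 x0.
rewrite scaler0 addr0 p0 => /(_ _); have := pp (2^-1 *: x).
have h : 0 < (2^-1 : R) < 1 by lra.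
by move=> A /(_ h); lra.
Qed.

Lemma good_itc_gt0 phi x : good phi -> x != 0 -> 0 < itc phi x.
Proof.
move=> [p0 pp sp C1p _] x0; have := tangent_lt sp C1p x0 (z := 0).
by rewrite dot0l p0 subr0 eq_sym => /(_ x0).
Qed.

Lemma itc_ray_ge phi (r M : R) y : good phi -> 0 < r ->
  (forall z, `|z| = r -> M <= itc phi z) -> r <= `|y| -> M <= itc phi y.
Proof.
move=> [p0 pp sp C1p _] r0 h ry.
have y0 : 0 < `|y| by exact: lt_le_trans ry.
have := itc_ray (scvx_cvx sp) C1p (l := r / `|y|) (x := y).
rewrite -normr_gt0 y0 divr_gt0//= ler_pdivrMr// mul1r ry => /(_ isT isT).
apply: le_trans; apply: h.
by rewrite normrZ ger0_norm ?divfK ?gt_eqF// divr_ge0 ?ltW.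
Qed.

(** On each ray the intercept exceeds [M] somewhere, hence also on nearby rays, and it stays above
    from there on by monotonicity. Compactness of the unit sphere makes the threshold uniform in the
    direction. *)
Lemma itc_infty phi (M : R) : good phi ->
  exists2 r, 0 < r & forall y, r <= `|y| -> M <= itc phi y.
Proof.
move=> gp; have [p0 pp sp C1p np] := gp.
have : \forall t \near +oo, [set y : V | `|y| = 1] `<=`
    (fun y => M <= itc phi (t *: y)).
  have /compact_near_coveringP : compact [set y : V | `|y| = 1].
    exact: compact_sphere.
  apply => x /= x1; have x0 := sphere_neq0 ltr01 x1.
  have [t t0 Mt] := nonlin_itc M (scvx_cvx sp) C1p p0 pp np x0.
  have tx0 : t *: x != 0 by rewrite scaler_eq0 negb_or gt_eqF.
  have /(@nbhs_cvgP R V) := itc_cvg C1p tx0.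
  move=> /(_ (itc phi (t *: x) - M)); rewrite subr_gt0 => /(_ Mt)[d d0 hd].
  have r0 : 0 < Num.min (d / t) 1 by rewrite lt_min divr_gt0/=.
  exists (ball x (Num.min (d / t) 1), [set s | t <= s]).
    split => /=; first exact: nbhsx_ballx.
    by apply: nbhs_pinfty_ge; exact: num_real.
  move=> [y s] /=; rewrite -ball_normE/= lt_min => -[/andP[xy xy1] ts].
  have y0 : y != 0.
    by apply/eqP => y0; move: xy1; rewrite y0 subr0 x1 ltxx.
  have s0 : 0 < s by exact: lt_le_trans ts.
  have : `|t *: y - t *: x| < d.
    by rewrite -scalerBr normrZ gtr0_norm// mulrC -ltr_pdivlMr// distrC.
  move=> /hd; rewrite ltr_distl => /andP[h _].
  apply: le_trans (_ : itc phi (t *: y) <= _); first by lra.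
  have -> : t *: y = (t / s) *: (s *: y) by rewrite scalerA divfK ?gt_eqF.
  apply: itc_ray => //; first exact: scvx_cvx.
    by rewrite scaler_eq0 negb_or gt_eqF.
  by rewrite divr_gt0//= ler_pdivrMr// mul1r.
move=> [s [_ hs]]; pose r := Num.max (s + 1) 1.
have r0 : 0 < r by rewrite lt_max ltr01 orbT.
have rn0 := lt0r_neq0 r0.
exists r => // y ry; apply: (itc_ray_ge gp r0 _ ry) => z zr.
have rs : s < r by rewrite lt_max ltrDl ltr01.
have -> : z = r *: (r^-1 *: z) by rewrite scalerA divff// scale1r.
apply: (hs r rs (r^-1 *: z)) => /=.
by rewrite normrZ zr ger0_norm ?invr_ge0 ?ltW// mulVf.
Qed.

(* This is the tangent at l *: y evaluated at y, scaled by l. *)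
Lemma tangent_ray phi x y (c l : R) : cvx phi -> C1_off0 phi -> y != 0 ->
  0 < l -> 0 <= c ->
  l * (dot x y - 1 - c * phi y) + (1 - l) * (c * itc phi (l *: y) - 1) <=
  dot x (l *: y) - 1 - c * phi (l *: y).
Proof.
move=> cp C1p y0 l0 c0.
have ly0 : l *: y != 0 by rewrite scaler_eq0 negb_or gt_eqF.
have := tangent_le y cp C1p ly0.
rewrite -(ler_pM2l l0) => /(ler_wpM2l c0).
by rewrite /itc dotZr !dotZl; set a := dot y _; set b := phi (l *: y); lra.
Qed.

(* The supremum of (dot x z - 1) / phi z over z is w, attained at y; written
   without division because phi 0 = 0. *)
Definition contact phi x y (w : R) : Prop :=
  dot x y = 1 + w * phi y /\ forall z, dot x z <= 1 + w * phi z.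

(** The quotient is maximized over a compact part of a ball. Points outside do no better: beyond
    radius [r] the intercept is at least [phi y1], so for a level [c >= (phi y1)^-1] the inequality
    [tangent_ray] moves a competitor to the sphere of radius [r] and keeps its excess over the level
    nonnegative. *)
Lemma contact_exists phi x : good phi -> x != 0 ->
  exists y w, 0 < w /\ contact phi x y w.
Proof.
move=> gp x0; have [p0 pp sp C1p np] := gp.
have cp := scvx_cvx sp.
(* A test point with pairing 2; its quotient is [(phi y1)^-1], the level from which on [scale]
   works. *)
pose y1 := (2 / dot x x) *: x.
have xx0 := dot_gt0 x0.
have dy1 : dot x y1 = 2 by rewrite dotZr divfK// gt_eqF.
have neq0 y : 1 <= dot x y -> y != 0.
  by move=> h; apply/eqP => y0; move: h; rewrite y0 dot0r; lra.
have y10 : y1 != 0 by apply: neq0; rewrite dy1; lra.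
have py1 : 0 < phi y1 by exact: good_gt0.
have [r r0 hr] := itc_infty (phi y1) gp.
(* The half-space keeps [K] away from 0, where [phi] vanishes; outside it the numerator of the
   quotient is negative. *)
pose K := [set y : V | `|y| <= r] `&` [set y : V | 1 <= dot x y].
have cdot : continuous (fun y : V => dot x y : R).
  move=> y; apply: (cvg_rsum (nbhs_filter y)) => i.
  apply: cvgM; first exact: cvg_cst.
  exact: coord_continuous.
have cK : compact K.
  apply: bounded_closed_compact.
    by exists r; split; [exact: num_real|move=> M rM y /= [yr _]; exact: le_trans (ltW rM)].
  apply: closedI.
    exact: (closed_comp (fun y _ => @norm_continuous _ _ y) (@closed_le _ r)).
  exact: (closed_comp (fun y _ => cdot y) (@closed_ge _ 1)).
pose f y := (dot x y - 1) / phi y.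
(* Scaling down to the sphere of radius r stays in the superlevel sets of f. *)
have scale y c : y != 0 -> (phi y1)^-1 <= c -> r <= `|y| ->
    0 <= dot x y - 1 - c * phi y ->
    exists l : R, [/\ 0 < l, `|l *: y| = r &
      l * (dot x y - 1 - c * phi y) <= dot x (l *: y) - 1 - c * phi (l *: y)].
  move=> y0 hc ry hy; have ny : 0 < `|y| by rewrite normr_gt0.
  have c0 : 0 < c by apply: lt_le_trans hc; rewrite invr_gt0.
  exists (r / `|y|); have l0 : 0 < r / `|y| by rewrite divr_gt0.
  have nl : `|(r / `|y|) *: y| = r by rewrite normrZ gtr0_norm// divfK ?gt_eqF.
  split => //; apply: le_trans (tangent_ray x cp C1p y0 l0 (ltW c0)).
  rewrite lerDl mulr_ge0//; first by rewrite subr_ge0 ler_pdivrMr// mul1r.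
  rewrite subr_ge0; have := hr ((r / `|y|) *: y); rewrite nl lexx => /(_ isT) h.
  apply: le_trans (_ : c * phi y1 <= _); last by rewrite ler_wpM2l// ltW.
  by rewrite -ler_pdivrMr// mul1r.
(* The test point may itself lie outside the ball; its rescaling to the sphere then replaces it. *)
have [y2 Ky2 fy2] : exists2 y, K y & (phi y1)^-1 <= f y.
  have [y1r|/ltW ry1] := leP `|y1| r.
    exists y1; first by split=> //=; rewrite dy1; lra.
    by rewrite /f dy1 (_ : 2 - 1 = 1) ?mul1r//; lra.
  have [|l [l0 nl]] := scale y1 (phi y1)^-1 y10 (lexx _) ry1.
    by rewrite dy1 mulVf ?gt_eqF//; lra.
  rewrite dy1 mulVf ?gt_eqF//.
  have -> : l * (2 - 1 - 1) = 0 by lra.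
  move=> h; have ly0 : l *: y1 != 0 by rewrite scaler_eq0 negb_or gt_eqF.
  have ply : 0 < phi (l *: y1) by exact: good_gt0.
  exists (l *: y1).
    split => /=; first by rewrite nl.
    have : 0 <= (phi y1)^-1 * phi (l *: y1) by rewrite mulr_ge0// invr_ge0.
    lra.
  by rewrite /f ler_pdivlMr//; lra.
have [|y] := EVT_max_rV (ex_intro _ y2 Ky2) cK (f := f).
  apply/subspace_continuousP => y [_ /= /neq0 y0]; apply: cvg_within_filter.
  apply: cvgM; first by apply: cvgB; [exact: cdot|exact: cvg_cst].
  by apply: cvgV; [rewrite gt_eqF// good_gt0|exact: C1_off0_cvg].
rewrite inE => -[yr /= xy1] hmax.
have y0 := neq0 _ xy1; have py := good_gt0 gp y0.
have fw : (phi y1)^-1 <= f y by apply: (le_trans fy2); apply: hmax; rewrite inE.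
have fw0 : 0 < f y by apply: lt_le_trans fw; rewrite invr_gt0.
exists y, (f y); split => //; split; first by rewrite divfK ?gt_eqF//; lra.
have hK z : K z -> dot x z <= 1 + f y * phi z.
  move=> Kz; have := hmax z; rewrite inE => /(_ Kz).
  by rewrite [f z]/f ler_pdivrMr ?(good_gt0 gp (neq0 _ Kz.2))//; lra.
move=> z; rewrite leNgt; apply/negP => hz.
have xz1 : 1 <= dot x z.
  by have := mulr_ge0 (ltW fw0) (pp z); lra.
have [zr|/ltW rz] := leP `|z| r.
  by have := hK z (conj zr xz1); lra.
have [|l [l0 nl h]] := scale z _ (neq0 _ xz1) fw rz; first by lra.
have lt0 : 0 < l * (dot x z - 1 - f y * phi z) by rewrite mulr_gt0//; lra.
have Klz : K (l *: z).
  split => /=; first by rewrite nl.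
  by have := mulr_ge0 (ltW fw0) (pp (l *: z)); lra.
by have := hK _ Klz; lra.
Qed.

End Good.

(** * Contact points and the polar *)

Section Contact.
Context {R : realType} {n : nat}.
Local Notation V := 'rV[R]_n.
Implicit Types (phi psi : V -> R) (x y z v : V) (w : R).

Lemma contact_neq0 phi x y w : phi 0 = 0 -> contact phi x y w -> y != 0.
Proof.
move=> p0 [h _]; apply/eqP => y0.
by move: h; rewrite y0 dot0r p0 mulr0; lra.
Qed.

(** [y] maximizes [dot x z - w * phi z] over [z], so one-sided derivatives give an inequality in
    every direction; the direction [x - w *: grad phi y] turns it into the equality. *)
Lemma contact_grad phi x y w : C1_off0 phi -> y != 0 -> contact phi x y w ->
  x = w *: grad phi y.
Proof.
move=> C1p y0 [h1 h2].
have le v : dot x v <= w * dot v (grad phi y).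
  have := derive_cvg (v := v) C1p y0.
  move=> /cvg_dnbhs_at_right/(cvgM (cvg_cst w))/cvgr_to_ge; apply; near=> h.
  have h0 : 0 < h by near: h; exact: nbhs_right_gt.
  have := h2 (h *: v + y); rewrite dotDr h1 dotZr.
  rewrite /shift/= => hz; rewrite [_ *: _]/(h^-1 * _) mulrCA.
  rewrite ler_pdivlMl// mulrBr; lra.
apply/eqP; rewrite -subr_eq0; apply/negPn/negP => /dot_gt0.
rewrite [X in X -> _]/is_true dotBl dotZl (dotC (grad _ _)); have := le (x - w *: grad phi y).
lra.
Unshelve. all: by end_near. Qed.

Lemma contact_itc phi x y w : C1_off0 phi -> y != 0 -> w != 0 ->
  contact phi x y w -> itc phi y = w^-1.
Proof.
move=> C1p y0 w0 cp; have := contact_grad C1p y0 cp; have [+ _] := cp.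
rewrite /itc => + xE; rewrite xE dotZl dotC => h.
by apply: (mulfI w0); rewrite mulrBr h divff//; ring.
Qed.

Lemma contact_uniq phi x y1 y2 w : scvx phi -> 0 < w ->
  contact phi x y1 w -> contact phi x y2 w -> y1 = y2.
Proof.
move=> sp w0 [h1 l1] [h2 l2]; apply/eqP/negPn/negP => ne.
have h : 0 < (2^-1 : R) < 1 by lra.
have := sp _ _ _ ne h; rewrite -(ltr_pM2l w0).
have := l1 (2^-1 *: y1 + (1 - 2^-1) *: y2).
rewrite dotDr !dotZr h1 h2; lra.
Qed.

Lemma polar_contact phi x y w : 0 <= w -> 0 < phi y -> contact phi x y w ->
  polar (EFin \o phi) x = w%:E.
Proof.
move=> w0 py [h1 h2]; apply/eqP; rewrite eq_le; apply/andP; split.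
  apply: ereal_inf_lbound; exists w => //; split => // z.
  by rewrite /= -EFinM -EFinD lee_fin dotC.
apply: le_ereal_inf_tmp => _ [c [c0 hc] <-]; rewrite lee_fin.
have := hc y; rewrite /= -EFinM -EFinD lee_fin dotC h1 lerD2l.
by rewrite ler_pM2r.
Qed.

Lemma polar0 (psi : V -> \bar R) : polar psi 0 = 0%E.
Proof.
apply/eqP; rewrite eq_le; apply/andP; split.
  apply: ereal_inf_lbound; exists 0 => //; split => // z.
  by rewrite dot0r mul0e adde0 lee_fin.
by apply: le_ereal_inf_tmp => _ [c [c0 _] <-]; rewrite lee_fin.
Qed.

Lemma legendre_contact phi x y w : 0 < w -> contact phi x y w ->
  legendre (EFin \o phi) (w^-1 *: x) = (w^-1)%:E.
Proof.
move=> w0 [h1 h2]; apply/eqP; rewrite eq_le; apply/andP; split.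
  apply: ge_ereal_sup => _ [z _ <-]; rewrite /= -EFinB lee_fin dotZr dotC.
  by rewrite -(ler_pM2l w0) mulrBr mulrA divff ?gt_eqF// mul1r; have := h2 z; lra.
apply: ereal_sup_ubound; exists y => //; rewrite /= -EFinB dotZr dotC h1.
by rewrite mulrDr mulrA mulVf ?gt_eqF// mul1r mulr1 addrK.
Qed.

Definition pol phi x : R := fine (polar (EFin \o phi) x).

(** No contact point exists at [x = 0], where the default 0 is returned; for [x != 0] and a good
    [phi] the point is unique. *)
Definition touch phi x : V := xget 0 [set y | contact phi x y (pol phi x)].

Lemma pol0 phi : pol phi 0 = 0.
Proof. by rewrite /pol polar0. Qed.

Section Good.
Variable phi : V -> R.
Hypothesis gp : good phi.

Lemma pol_exists x : x != 0 -> exists y,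
  [/\ contact phi x y (pol phi x), 0 < pol phi x &
      polar (EFin \o phi) x = (pol phi x)%:E].
Proof.
move=> x0; have [p0 _ _ _ _] := gp.
have [y [w [w0 c]]] := contact_exists gp x0; exists y.
have y0 := contact_neq0 p0 c.
by rewrite /pol (polar_contact (ltW w0) (good_gt0 gp y0) c).
Qed.

Lemma touchP x : x != 0 -> contact phi x (touch phi x) (pol phi x).
Proof.
move=> x0; have [y [c _ _]] := pol_exists x0.
exact: (xgetI (P := [set y | contact phi x y (pol phi x)]) 0 c).
Qed.

Lemma touch_neq0 x : x != 0 -> touch phi x != 0.
Proof. by move=> x0; apply: contact_neq0 (touchP x0); case: gp. Qed.

Lemma pol_gt0 x : x != 0 -> 0 < pol phi x.
Proof. by move=> x0; have [y []] := pol_exists x0. Qed.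

Lemma pol_ge0 x : 0 <= pol phi x.
Proof. by have [->|/pol_gt0/ltW//] := eqVneq x 0; rewrite pol0. Qed.

Lemma polarE x : polar (EFin \o phi) x = (pol phi x)%:E.
Proof.
by have [->|x0] := eqVneq x 0; [rewrite pol0 polar0|have [y []] := pol_exists x0].
Qed.

Lemma pol_ub x z : dot x z <= 1 + pol phi x * phi z.
Proof.
have [->|x0] := eqVneq x 0; first by rewrite dot0l pol0 mul0r addr0.
exact: (touchP x0).2.
Qed.

Lemma touch_eq x y : x != 0 -> contact phi x y (pol phi x) -> y = touch phi x.
Proof.
move=> x0 c; have [_ _ sp _ _] := gp.
exact: (contact_uniq sp (pol_gt0 x0) c (touchP x0)).
Qed.

Lemma contact_sym x y : contact phi x y (pol phi x) -> contact (pol phi) y x (phi y).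
Proof.
move=> [h _]; split; first by rewrite dotC h mulrC.
by move=> z; rewrite dotC mulrC; exact: pol_ub.
Qed.

(** The contact relation is the tangent inequality at [y] divided by the intercept. So every nonzero
    [y] occurs as a contact point. *)
Lemma contact_of_point y : y != 0 ->
  contact phi ((itc phi y)^-1 *: grad phi y) y (itc phi y)^-1.
Proof.
move=> y0; have i0 := good_itc_gt0 gp y0; have [p0 pp sp C1p np] := gp.
split.
  rewrite dotZl dotC -[1](mulVf (lt0r_neq0 i0)) -mulrDr; congr (_ * _).
  by rewrite /itc subrK.
move=> z; rewrite dotZl -[1](mulVf (lt0r_neq0 i0)) -mulrDr.
rewrite ler_pM2l ?invr_gt0// dotC; have := tangent_le z (scvx_cvx sp) C1p y0.
lra.
Qed.

Lemma pol_of_point y : y != 0 ->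
  contact phi ((itc phi y)^-1 *: grad phi y) y
    (pol phi ((itc phi y)^-1 *: grad phi y)) /\ (itc phi y)^-1 *: grad phi y != 0.
Proof.
move=> y0; have i0 := good_itc_gt0 gp y0; have c := contact_of_point y0.
split; last first.
  apply/eqP => x0; case: c; rewrite x0 dot0l => + _.
  have : 0 <= (itc phi y)^-1 * phi y.
    by rewrite mulr_ge0// ?invr_ge0 ltW// good_gt0.
  lra.
rewrite /pol (polar_contact _ _ c) ?good_gt0//.
by rewrite invr_ge0 ltW.
Qed.

(** [y] is the contact point of some [x]; by symmetry [x] is a contact point of the polar at [y],
    with value [phi y]. *)
Lemma pol_polarE y : polar (EFin \o pol phi) y = (phi y)%:E.
Proof.
have [->|y0] := eqVneq y 0; first by rewrite polar0; case: gp => ->.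
have [c x0] := pol_of_point y0.
apply: polar_contact (contact_sym c); last exact: pol_gt0.
by rewrite ltW// good_gt0.
Qed.

(** Equality at [m] would make the contact point [y] of [m] one of [x1] and of [x2] as well. But [y]
    determines its partner, the gradient at [y] over the intercept, so [x1 = x2]. At [m = 0], where
    no contact point exists, positivity of the polar suffices. *)
Lemma scvx_pol : scvx (pol phi).
Proof.
move=> x1 x2 t x12 /andP[t0 t1]; have t1' : 0 < 1 - t by rewrite subr_gt0.
have [p0 pp sp C1p np] := gp.
set m := t *: x1 + (1 - t) *: x2.
have [m0|m0] := eqVneq m 0.
  rewrite m0 pol0; have [x10|x10] := eqVneq x1 0.
    rewrite x10 pol0 mulr0 add0r mulr_gt0// pol_gt0//.
    by rewrite eq_sym -x10.
  by rewrite ltr_pwDl ?mulr_gt0 ?pol_gt0// mulr_ge0 ?pol_ge0// ltW.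
set y := touch phi m; have cy : contact phi m y (pol phi m) := touchP m0.
have y0 : y != 0 := touch_neq0 m0; have py : 0 < phi y := good_gt0 gp y0.
rewrite ltNge; apply/negP => ge.
have u1 := pol_ub x1 y; have u2 := pol_ub x2 y.
have E : t * (1 + pol phi x1 * phi y - dot x1 y) +
    (1 - t) * (1 + pol phi x2 * phi y - dot x2 y) <= 0.
  have [h _] := cy; move: h; rewrite /m dotDl !dotZl => h.
  have := ler_wpM2r (ltW py) ge; rewrite mulrDl; lra.
have d1 : 0 <= 1 + pol phi x1 * phi y - dot x1 y by rewrite subr_ge0.
have d2 : 0 <= 1 + pol phi x2 * phi y - dot x2 y by rewrite subr_ge0.
have tight x : dot x y = 1 + pol phi x * phi y ->
    x = (itc phi y)^-1 *: grad phi y.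
  move=> h; have c : contact phi x y (pol phi x) by split=> // z; exact: pol_ub.
  have x0 : x != 0.
    by apply/eqP => x0; move: h; rewrite x0 dot0l pol0 mul0r; lra.
  rewrite (contact_itc C1p y0 (lt0r_neq0 (pol_gt0 x0)) c) invrK.
  exact: contact_grad.
have e1 : t * (1 + pol phi x1 * phi y - dot x1 y) <= 0.
  by have := mulr_ge0 (ltW t1') d2; lra.
have e2 : (1 - t) * (1 + pol phi x2 * phi y - dot x2 y) <= 0.
  by have := mulr_ge0 (ltW t0) d1; lra.
rewrite pmulr_rle0// in e1; rewrite pmulr_rle0// in e2.
case/eqP: x12; rewrite (tight x1) 1?(tight x2)//; lra.
Qed.

Lemma cvx_pol : cvx (pol phi).
Proof. exact: scvx_cvx scvx_pol. Qed.

Lemma pol_ray_ge x (t : R) : 1 <= t -> t * pol phi x <= pol phi (t *: x).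
Proof.
move=> t1; have t0 : 0 < t by exact: lt_le_trans t1.
have := @ray_ge _ _ (pol phi) (t *: x) t^-1 cvx_pol (pol0 phi).
rewrite scalerA mulVf ?gt_eqF// scale1r invr_ge0 invf_le1// (ltW t0) t1.
by move=> /(_ isT); rewrite -(ler_pM2l t0) mulrA divff ?gt_eqF// mul1r.
Qed.

(* The intercept of the polar at x is 1 / phi y for the contact point y, and
   y tends to 0 along rays because the intercept of phi at y is 1 / pol x. *)
Lemma nonlin_pol : C1_off0 (pol phi) -> nonlin (pol phi).
Proof.
move=> C1W; apply: itc_nonlin => //; first exact: cvx_pol.
move=> x M x0; have [p0 pp sp C1p np] := gp.
have [B B0 hB] : exists2 B, 0 < B & forall y : V, `|y| = 1 -> phi y <= B.
  apply: (@compact_ubound _ _ [set y | `|y| = 1]); first exact: compact_sphere.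
  by move=> y /= /(sphere_neq0 ltr01) y0; exact: C1_off0_cvg.
pose M' := `|M| + 1; have M'0 : 0 < M' by rewrite ltr_wpDl.
have MM' : M < M' by rewrite (le_lt_trans (ler_norm _))// ltrDl.
(* Chosen so that a point [y] of norm below [r] has [phi y] below [1 / M']; the cap 1 permits
   convexity on the segment from 0. *)
pose r := Num.min 1 (M' * B)^-1.
have r0 : 0 < r by rewrite lt_min ltr01 invr_gt0 mulr_gt0.
have [m m0 hm] : exists2 m, 0 < m & forall y : V, `|y| = r -> m <= itc phi y.
  apply: (@compact_pos_lbound _ _ [set y | `|y| = r]); first exact: compact_sphere.
    by move=> y /= /(sphere_neq0 r0) y0; exact: itc_cvg.
  by move=> y /= /(sphere_neq0 r0) y0; exact: good_itc_gt0.
(* Makes the polar at [t *: x] at least [2 / m], so that the intercept of [phi] at the contact point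
   is below [m]. *)
pose t := Num.max 1 (2 * (m * pol phi x)^-1).
have px := pol_gt0 x0.
have t1 : 1 <= t by rewrite le_max lexx.
have t0 : 0 < t by exact: lt_le_trans t1.
exists t => //; have tx0 : t *: x != 0 by rewrite scaler_eq0 negb_or gt_eqF.
set y := touch phi (t *: x).
have c : contact phi (t *: x) y (pol phi (t *: x)) := touchP tx0.
have y0 : y != 0 := touch_neq0 tx0; have py := good_gt0 gp y0.
rewrite (contact_itc C1W tx0 (lt0r_neq0 py) (contact_sym c)).
have W0 := pol_gt0 tx0.
have iy := contact_itc C1p y0 (lt0r_neq0 W0) c.
have yr : `|y| < r.
  rewrite ltNge; apply/negP => ry; have := itc_ray_ge gp r0 hm ry.
  apply/negP; rewrite -ltNge iy -[m]invrK ltf_pV2 ?posrE ?invr_gt0//.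
  apply: lt_le_trans (pol_ray_ge x t1).
  apply: (@lt_le_trans _ _ (2 * (m * pol phi x)^-1 * pol phi x)); last first.
    by rewrite ler_wpM2r ?(ltW px)// le_max lexx orbT.
  rewrite invfM -!mulrA mulVf ?gt_eqF// mulr1 ltr_pMl ?invr_gt0//; lra.
have ny : 0 < `|y| by rewrite normr_gt0.
have : phi y <= `|y| * B.
  have yE : y = `|y| *: (`|y|^-1 *: y).
    by rewrite scalerA divff ?gt_eqF// scale1r.
  rewrite {1}yE; apply: (@le_trans _ _ (`|y| * phi (`|y|^-1 *: y))).
    apply: ray_ge => //; first exact: scvx_cvx.
    by rewrite ltW//= ltW// (lt_le_trans yr)// ge_min lexx.
  rewrite ler_pM2l// hB// normrZ ger0_norm ?invr_ge0//.
  by rewrite mulVf ?gt_eqF.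
move=> pyB; apply: (lt_trans MM').
rewrite -[M']invrK ltf_pV2 ?posrE ?invr_gt0// (le_lt_trans pyB)//.
rewrite -ltr_pdivlMr// -invfM (lt_le_trans yr)// ge_min.
by apply/orP; right.
Qed.

Lemma good_pol : C1_off0 (pol phi) -> good (pol phi).
Proof.
move=> C1W; split => //; first exact: pol0.
- exact: pol_ge0.
- exact: scvx_pol.
- exact: nonlin_pol.
Qed.

End Good.
End Contact.

(** * The polar of a family: first derivatives *)

Section Family.
Context {R : realType} {n : nat}.
Local Notation V := 'rV[R]_n.
Local Notation E := (R * V)%type.

Lemma compact_covering_within (K : set V) (D : set E) (p : E) (P : E -> V -> Prop) :
  compact K ->
  (forall y, K y -> exists2 d, 0 < d & forall q z, D q -> K z ->
     `|q - p| < d -> `|z - y| < d -> P q z) ->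
  exists2 d, 0 < d & forall q z, D q -> K z -> `|q - p| < d -> P q z.
Proof.
move=> /compact_near_coveringP/near_covering_withinP cK h.
have : \forall q \near within D (nbhs p), K `<=` P q.
  apply: cK => y Ky; have [d d0 hd] := h y Ky.
  exists (ball y d, D `&` ball p d) => /=.
    split; first exact: nbhsx_ballx.
    rewrite /within/=; apply: filterS (nbhsx_ballx p _ d0) => q pq Dq.
    by split.
  move=> [z q] /= [yz [Dq pq]] Kz; apply: hd => //; rewrite distrC.
    by move: pq; rewrite -ball_normE.
  by move: yz; rewrite -ball_normE.
rewrite /prop_near1/within/= => /nbhs_normP[d /= d0 hd].
exists d => // q z Dq Kz qp; apply: (hd q) => //=.
by rewrite distrC.
Qed.

Variable H : R -> V -> R.
Hypothesis gH : forall t, 0 <= t -> good (H t).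
Hypothesis C1H : C1_spacetime H.

Let W t x := pol (H t) x.
Let Y t x := touch (H t) x.
(** Slack in the contact inequality, free of division. For [y != 0] it increases with [w]; at
    [w = W] it is nonnegative and vanishes only at the contact point. *)
Let gap (w : R) (q : E) (y : V) : R := 1 + w * H q.1 y - dot q.2 y.

Let spread : set (E * V) := [set z | spacetime z.1 /\ z.2 != 0].

Lemma lift_cvg (f : E -> R) (p : E) (y : V) : spacetime p -> y != 0 ->
  (forall q, spacetime q -> f @ within spacetime (nbhs q) --> f q) ->
  (fun z : E * V => f (z.1.1, z.2)) @ within spread (nbhs (p, y)) --> f (p.1, y).
Proof.
move=> Dp y0 cf; have Dpy : spacetime (p.1, y) by case: Dp.
have /within_cvgP h := cf _ Dpy; apply/within_cvgP => e /h[d d0 hd].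
exists d => // -[[t x] z] [[/= t0 x0] z0]; rewrite !prod_normE/= !gt_max.
move=> /andP[/andP[tp _] zy]; apply: hd => //.
by rewrite prod_normE/= gt_max tp.
Qed.

Lemma gap_cvg (w : R) (p : E) (y : V) : spacetime p -> y != 0 ->
  forall e, 0 < e -> exists2 d, 0 < d & forall q z, spacetime q -> z != 0 ->
    `|q - p| < d -> `|z - y| < d -> `|gap w q z - gap w p y| < e.
Proof.
move=> Dp y0 e e0.
have : (fun z : E * V => gap w z.1 z.2) @ within spread (nbhs (p, y)) --> gap w p y.
  apply: cvgB.
    apply: cvgD; first exact: cvg_cst.
    apply: cvgM; first exact: cvg_cst.
    apply: (lift_cvg (f := unc H)) => // q Dq.
    by have [/subspace_continuousP/(_ _ Dq)] := C1H.
  have dfst : sdiff spread (fun z : E * V => z.1.2) (p, y) (fun z => z.1.2).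
    apply: sdiff_blin => //.
    by apply: (blin_comp (L := fst : E * V -> E) (M := snd : E -> V));
      [exact: blin_fst|exact: blin_snd].
  have dsnd : sdiff spread (snd : E * V -> V) (p, y) snd.
    by apply: sdiff_blin => //; exact: blin_snd.
  exact: (sdiff_cvg (sdiff_dot dfst dsnd)).
move=> /within_cvgP/(_ _ e0)[d d0 hd]; exists d => // q z Dq z0 qp zy.
by apply: (hd (q, z)) => //; rewrite prod_normE/= gt_max qp.
Qed.

Lemma gap_Y q : spacetime q -> gap (W q.1 q.2) q (Y q.1 q.2) = 0.
Proof.
by move=> [q1 q2]; have [h _] := touchP (gH q1) q2; rewrite /gap h subrr.
Qed.

Lemma gap_ge0 q y : spacetime q -> 0 <= gap (W q.1 q.2) q y.
Proof. by move=> [q1 q2]; rewrite subr_ge0; exact: (pol_ub (gH q1)). Qed.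

Lemma gap_lt w w' q y : spacetime q -> y != 0 ->
  (gap w q y < gap w' q y) = (w < w').
Proof.
move=> [q1 q2] y0; rewrite /gap ltrD2r ltrD2l ltr_pM2r//.
exact: good_gt0 (gH q1) y0.
Qed.

Lemma gap_eq0 p y : spacetime p -> gap (W p.1 p.2) p y = 0 -> y = Y p.1 p.2.
Proof.
move=> [p1 p2] /eqP; rewrite subr_eq0 => /eqP h.
apply: (touch_eq (gH p1) p2); split=> // z; exact: (pol_ub (gH p1)).
Qed.

Let Y_neq0 q : spacetime q -> Y q.1 q.2 != 0.
Proof. by move=> [q1 q2]; exact: (touch_neq0 (gH q1)). Qed.

Let W_gt0 q : spacetime q -> 0 < W q.1 q.2.
Proof. by move=> [q1 q2]; exact: (pol_gt0 (gH q1)). Qed.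

(** Lower semicontinuity of a supremum of continuous functions: the contact point of [p] serves as
    test point for all nearby [q]. *)
Lemma W_lower p (w : R) : spacetime p -> w < W p.1 p.2 ->
  exists2 d, 0 < d & forall q, spacetime q -> `|q - p| < d -> w < W q.1 q.2.
Proof.
move=> Dp wp; have y0 := Y_neq0 Dp.
have : gap w p (Y p.1 p.2) < 0 by rewrite -(gap_Y Dp) gap_lt.
rewrite -oppr_gt0 => g0; have [d d0 hd] := gap_cvg w Dp y0 g0.
exists d => // q Dq qp.
have := hd q (Y p.1 p.2) Dq y0 qp; rewrite subrr normr0 => /(_ d0).
rewrite ltr_distl addrN => /andP[_ g]; rewrite -(gap_lt _ _ Dq y0).
exact: lt_le_trans g (gap_ge0 _ Dq).
Qed.

(** The intercept at the contact point of [q] is the reciprocal of [W] at [q], below [2 / w] near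
    [p] by [W_lower]; outside a fixed ball the intercepts of the nearby [H q.1] are at least
    [2 / w]. *)
Lemma Y_bounded p : spacetime p -> exists2 r, 0 < r & exists2 d, 0 < d &
  forall q, spacetime q -> `|q - p| < d -> `|Y q.1 q.2| <= r.
Proof.
move=> Dp; have w0 := W_gt0 Dp; set w := W p.1 p.2 in w0.
(* The extra 1 absorbs the change of the intercept on the sphere when [p] moves to [q]. *)
have [r r0 hr] := itc_infty (2 / w + 1) (gH Dp.1).
exists r => //.
have [d1 d10 h1] : exists2 d, 0 < d & forall q z, spacetime q ->
    [set z : V | `|z| = r] z -> `|q - p| < d -> 2 / w <= itc (H q.1) z.
  apply: compact_covering_within => [|y /= yr]; first exact: compact_sphere.
  have y0 := sphere_neq0 r0 yr.
  have /within_cvgP/(_ _ ltr01)[d d0 hd] :=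
    lift_cvg (f := fun q => itc (H q.1) q.2) Dp y0
      (fun q Dq => itc_spacetime_cvg C1H Dq).
  exists d => // q z Dq zr qp zy.
  have z0 := sphere_neq0 r0 zr.
  have := hd (q, z) (conj Dq z0); rewrite prod_normE/= gt_max qp zy => /(_ isT).
  rewrite ltr_distl => /andP[h _].
  by have := hr y; rewrite yr lexx => /(_ isT); lra.
have w2 : w / 2 < w by lra.
have [d2 d20 h2] := W_lower Dp w2.
exists (Num.min d1 d2); first by rewrite lt_min d10.
move=> q Dq; rewrite lt_min => /andP[q1 q2].
rewrite leNgt; apply/negP => /ltW ry.
have gq := gH Dq.1; have [_ _ _ C1q _] := gq.
have := itc_ray_ge gq r0 (fun z zr => h1 q z Dq zr q1) ry.
rewrite (contact_itc C1q (Y_neq0 Dq) (lt0r_neq0 (W_gt0 Dq)) (touchP gq Dq.2)).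
apply/negP; rewrite -ltNge -[2 / w]invrK invf_div ltf_pV2 ?posrE ?W_gt0//.
  exact: h2.
by rewrite divr_gt0.
Qed.

(** On the compact set of bounded points away from 0 and at distance at least [e] from the limit,
    the gap at [p] is positive, and it remains so for nearby [q]; but it vanishes at the contact
    point of [q]. *)
Lemma Y_cvg p : spacetime p ->
  (fun q => Y q.1 q.2) @ within spacetime (nbhs p) --> Y p.1 p.2.
Proof.
move=> Dp; apply/(@within_cvgP R E V) => e e0.
have [r r0 [d1 d10 h1]] := Y_bounded Dp.
set y0 := Y p.1 p.2; have y0n : y0 != 0 := Y_neq0 Dp.
(* A contact point satisfies [1 <= dot q.2 y], so its norm is at least [c^-1]; this keeps it away
   from 0, where no regularity of [H] is assumed. *)
pose c : R := 2 * (n%:R * (`|p.2| + 1)) + 1.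
have c0 : 0 < c by rewrite ltr_wpDl// !mulr_ge0// addr_ge0.
pose K := [set y : V | `|y| <= r] `&`
   ([set y : V | e <= `|y - y0|] `&` [set y : V | c^-1 <= `|y|]).
have cK : compact K.
  apply: bounded_closed_compact.
    by exists r; split; [exact: num_real|move=> M rM y /= [yr _]; exact: le_trans (ltW rM)].
  apply: closedI.
    exact: (closed_comp (fun y _ => @norm_continuous _ _ y) (@closed_le _ r)).
  apply: closedI; last first.
    exact: (closed_comp (fun y _ => @norm_continuous _ _ y) (@closed_ge _ c^-1)).
  apply: (closed_comp (f := fun y : V => `|y - y0|) _ (@closed_ge _ e)) => y _.
  apply/(@nbhs_cvgP R V R) => e' e'0; exists e' => // z.
  by apply: le_lt_trans; rewrite (le_trans (ler_dist_dist _ _))// opprB subrKA.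
have [d2 d20 h2] : exists2 d, 0 < d & forall q z, spacetime q ->
    K z -> `|q - p| < d -> 0 < gap (W q.1 q.2) q z.
  apply: compact_covering_within => // y [/= yr [ye yc]].
  have yn : y != 0 by rewrite -normr_gt0 (lt_le_trans _ yc)// invr_gt0.
  have g0 : 0 < gap (W p.1 p.2) p y.
    rewrite lt_neqAle gap_ge0// andbT eq_sym; apply/eqP => /(gap_eq0 Dp) yE.
    by move: ye; rewrite yE subrr normr0 leNgt e0.
  have hy := good_gt0 (gH Dp.1) yn.
  (* Only lower semicontinuity of [W] is available here. Lowering the level to [w] halves the gap,
     and for nearby [q] the true gap is larger because [W] exceeds [w] there. *)
  pose w := W p.1 p.2 - gap (W p.1 p.2) p y / (2 * H p.1 y).
  have wp : w < W p.1 p.2 by rewrite /w ltrBlDr ltrDl divr_gt0// mulr_gt0.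
  have gw : 0 < gap w p y.
    have -> : gap w p y = gap (W p.1 p.2) p y / 2.
      by rewrite {1}/gap /w /gap; field; rewrite gt_eqF.
    by rewrite divr_gt0.
  have [d3 d30 h3] := gap_cvg w Dp yn gw; have [d4 d40 h4] := W_lower Dp wp.
  exists (Num.min d3 d4); first by rewrite lt_min d30.
  move=> q z Dq [_ [_ zc]]; rewrite !lt_min => /andP[q3 q4] /andP[z3 z4].
  have zn : z != 0 by rewrite -normr_gt0 (lt_le_trans _ zc)// invr_gt0.
  have := h3 q z Dq zn q3 z3; rewrite ltr_distl subrr => /andP[g _].
  by apply: lt_trans g _; rewrite gap_lt// h4.
exists (Num.min (Num.min d1 d2) 1); first by rewrite !lt_min d10 d20 ltr01.
move=> q Dq; rewrite !lt_min -andbA => /and3P[q1 q2 q3].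
rewrite ltNge; apply/negP => ye.
have : K (Y q.1 q.2).
  split; first exact: h1.
  split => //=; rewrite -div1r ler_pdivrMr//.
  have [h _] := touchP (gH Dq.1) Dq.2.
  have : 1 <= dot q.2 (Y q.1 q.2).
    rewrite h lerDl mulr_ge0 ?(ltW (W_gt0 Dq))//.
    by rewrite ltW// (good_gt0 (gH Dq.1))// Y_neq0.
  move=> /le_trans/(_ (ler_norm _))/le_trans/(_ (dot_le _ _)).
  have q2p : `|q.2| <= `|p.2| + 1.
    rewrite -(subrK p.2 q.2) (le_trans (ler_normD _ _))// addrC lerD2l.
    exact: le_trans (norm_snd_le (q - p)) (ltW q3).
  move=> /le_trans; apply; rewrite mulrA [leRHS]mulrC /c.
  rewrite ler_wpM2r//; have : n%:R * `|q.2| <= n%:R * (`|p.2| + 1) :> R.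
    by rewrite ler_wpM2l.
  have : 0 <= n%:R * (`|p.2| + 1) :> R by rewrite mulr_ge0// addr_ge0.
  lra.
by move=> /(h2 _ _ Dq)/(_ q2); rewrite gap_Y// ltxx.
Qed.

(** The upper half uses moving test points: the gap at level [W p.1 p.2 + e] stays positive at the
    contact points of nearby [q]. *)
Lemma W_cvg p : spacetime p ->
  (fun q => W q.1 q.2) @ within spacetime (nbhs p) --> W p.1 p.2.
Proof.
move=> Dp; apply/(@within_cvgP R E R) => e e0.
have y0 := Y_neq0 Dp.
have wl : W p.1 p.2 - e < W p.1 p.2 by rewrite ltrBlDr ltrDl.
have wr : W p.1 p.2 < W p.1 p.2 + e by rewrite ltrDl.
have [d1 d10 h1] := W_lower Dp wl.
have : 0 < gap (W p.1 p.2 + e) p (Y p.1 p.2) by rewrite -(gap_Y Dp) gap_lt.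
move=> g0; have [d2 d20 h2] := gap_cvg (W p.1 p.2 + e) Dp y0 g0.
have /(@within_cvgP R E V)/(_ _ d20)[d3 d30 h3] := Y_cvg Dp.
exists (Num.min (Num.min d1 d2) d3); first by rewrite !lt_min d10 d20.
move=> q Dq; rewrite !lt_min -andbA => /and3P[q1 q2 q3].
rewrite ltr_distl h1//=.
have := h2 q _ Dq (Y_neq0 Dq) q2 (h3 q Dq q3).
by rewrite ltr_distl subrr => /andP[+ _]; rewrite -(gap_Y Dq) gap_lt// Y_neq0.
Qed.

Lemma HY_cvg p (f : E -> R) : spacetime p ->
  (forall q, spacetime q -> f @ within spacetime (nbhs q) --> f q) ->
  (fun q => f (q.1, Y q.1 q.2)) @ within spacetime (nbhs p) --> f (p.1, Y p.1 p.2).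
Proof.
move=> Dp cf; have DY q : spacetime q -> spacetime (q.1, Y q.1 q.2).
  by move=> Dq; split; [exact: Dq.1|exact: Y_neq0].
have /within_cvgP h := cf _ (DY _ Dp).
apply/(@within_cvgP R E R) => e /h[d d0 hd].
have /(@within_cvgP R E V)/(_ _ d0)[d' d'0 hd'] := Y_cvg Dp.
exists (Num.min d d'); first by rewrite lt_min d0.
move=> q Dq; rewrite lt_min => /andP[qd qd']; apply: hd; first exact: DY.
rewrite prod_normE/= gt_max hd'// andbT.
exact: le_lt_trans (norm_fst_le (q - p)) qd.
Qed.

Definition pol_diff (t : R) (x : V) (v : E) : R :=
  dot v.2 ((H t (Y t x))^-1 *: Y t x) -
  v.1 * (W t x * (H t (Y t x))^-1 * dt H t (Y t x)).

Lemma blin_pol_diff t x : blin (pol_diff t x).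
Proof.
apply: (blin_add (L1 := fun v : E => dot v.2 _)
  (L2 := fun v : E => - (v.1 * (W t x * (H t (Y t x))^-1 * dt H t (Y t x))))).
  exact: (blin_comp blin_snd (blin_dotl _)).
set c := _ * dt _ _ _; split=> [a u v|].
  by rewrite /= /GRing.scale/=; ring.
by exists `|c| => // v; rewrite normrN normrM mulrC ler_wpM2l// norm_fst_le.
Qed.

(* Comparing the maximizers at two nearby points bounds the increment of the
   polar by the increment of the function being maximized. *)
Lemma pol_increment p : spacetime p -> forall e, 0 < e -> exists2 d, 0 < d &
  forall a b, spacetime a -> spacetime b -> `|a - p| < d -> `|b - p| < d ->
    W a.1 a.2 - W b.1 b.2 - pol_diff p.1 p.2 (a - b) <= e * `|a - b|.
Proof.
move=> Dp e e0; set y0 := Y p.1 p.2; set w0 := W p.1 p.2.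
have y0n : y0 != 0 := Y_neq0 Dp.
set k0 := (H p.1 y0)^-1; set A := dt H p.1 y0.
have h0 : 0 < H p.1 y0 := good_gt0 (gH Dp.1) y0n.
have k00 : 0 < k0 by rewrite invr_gt0.
have w00 : 0 < w0 := W_gt0 Dp.
(* [S1 * e1] bounds the variation of [wb * k]; [S] collects the coefficients of [hrho] and of the
   errors [t1], [t2], [t3] below. *)
pose S1 := k0 + 1 + w0; have S10 : 0 < S1 by rewrite /S1; lra.
pose S := n%:R + S1 * `|A| + (w0 * k0 + S1).
have wk0 : 0 < w0 * k0 by rewrite mulr_gt0.
have S0 : 0 < S.
  by rewrite /S ltr_wpDl ?addr_ge0 ?mulr_ge0 ?(ltW S10)//; lra.
pose e1 := Num.min 1 (e / S).
have e10 : 0 < e1 by rewrite lt_min ltr01 divr_gt0.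
have e11 : e1 <= 1 by rewrite ge_min lexx.
have e1S : e1 * S <= e by rewrite -ler_pdivlMr// ge_min lexx orbT.
have cH : (fun q => H q.1 (Y q.1 q.2)) @ within spacetime (nbhs p) --> H p.1 y0.
  apply: (HY_cvg (f := unc H)) => // q Dq.
  by have [/subspace_continuousP/(_ _ Dq)] := C1H.
have ck : (fun q => (H q.1 (Y q.1 q.2))^-1) @ within spacetime (nbhs p) --> k0.
  by apply: cvgV => //; rewrite gt_eqF.
have cYk : (fun q => (H q.1 (Y q.1 q.2))^-1 *: Y q.1 q.2) @
    within spacetime (nbhs p) --> k0 *: y0.
  by apply: cvgZ => //; exact: Y_cvg.
have [_ _ /(_ _ e10)[d1 d10 h1]] := C1_sdiff C1H Dp.1 y0n.
have /(@within_cvgP R E R)/(_ _ e10)[d2 d20 h2] := ck.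
have /(@within_cvgP R E V)/(_ _ e10)[d3 d30 h3] := cYk.
have /(@within_cvgP R E R)/(_ _ e10)[d4 d40 h4] := W_cvg Dp.
have /(@within_cvgP R E V)/(_ _ d10)[d5 d50 h5] := Y_cvg Dp.
exists (Num.min (Num.min d1 d2) (Num.min (Num.min d3 d4) d5)).
  by rewrite !lt_min d10 d20 d30 d40 d50.
move=> a b Da Db; rewrite !lt_min -!andbA.
move=> /and5P[a1 a2 a3 a4 a5] /and5P[b1 b2 b3 b4 b5].
set ya := Y a.1 a.2; set wa := W a.1 a.2; set wb := W b.1 b.2.
have yan : ya != 0 := Y_neq0 Da.
have ha : 0 < H a.1 ya := good_gt0 (gH Da.1) yan.
set k := (H a.1 ya)^-1; have k_0 : 0 < k by rewrite invr_gt0.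
set N := `|a - b|; have N0 : 0 <= N by rewrite normr_ge0.
have Nt : `|a.1 - b.1| <= N := norm_fst_le (a - b).
have Nx : `|a.2 - b.2| <= N := norm_snd_le (a - b).
pose rho := H a.1 ya - H b.1 ya - (a.1 - b.1) * A.
have hrho : `|rho| <= e1 * N.
  have near (c : E) : `|c - p| < d1 -> `|(c.1, ya) - (p.1, y0)| < d1.
    move=> cp; rewrite prod_normE/= gt_max h5// andbT.
    exact: le_lt_trans (norm_fst_le (c - p)) cp.
  have := h1 (a.1, ya) (b.1, ya) (conj Da.1 yan) (conj Db.1 yan)
    (near a a1) (near b b1).
  rewrite prod_normE/= /C1_diff/= subrr normr0 dot0l addr0 /unc/= max_l// -/rho.
  by move=> /le_trans; apply; rewrite ler_wpM2l// ltW.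
have step : wa - wb <= dot (a.2 - b.2) (k *: ya) - wb * k * ((a.1 - b.1) * A + rho).
  have := gap_Y Da; have := gap_ge0 ya Db; rewrite /gap -/wa -/wb -/ya.
  move=> gb ga; rewrite dotZr -(ler_pM2r ha) mulrBl.
  have -> : (k * dot (a.2 - b.2) ya - wb * k * ((a.1 - b.1) * A + rho)) * H a.1 ya
      = dot (a.2 - b.2) ya - wb * (H a.1 ya - H b.1 ya).
    by rewrite /rho /k; field; rewrite gt_eqF.
  by rewrite dotBl; lra.
have hk : `|k - k0| <= e1 by apply/ltW/h2.
have hw : `|wb - w0| <= e1 by apply/ltW/h4.
have kb : `|k| <= k0 + 1.
  rewrite -(subrK k0 k) (le_trans (ler_normD _ _))// addrC lerD//.
    by rewrite ger0_norm// ltW.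
  exact: le_trans e11.
have hwk : `|wb * k - w0 * k0| <= S1 * e1.
  have -> : wb * k - w0 * k0 = (wb - w0) * k + w0 * (k - k0) by ring.
  rewrite (le_trans (ler_normD _ _))// /S1 [leRHS]mulrDl lerD//.
    by rewrite normrM mulrC ler_pM.
  by rewrite normrM gtr0_norm// ler_wpM2l// ltW.
have wkb : `|wb * k| <= w0 * k0 + S1.
  rewrite -(subrK (w0 * k0) (wb * k)) (le_trans (ler_normD _ _))// addrC lerD//.
    by rewrite gtr0_norm.
  by rewrite (le_trans hwk)// ger_pMr.
have t1 : dot (a.2 - b.2) (k *: ya - k0 *: y0) <= n%:R * (N * e1).
  apply: le_trans (ler_norm _) _; apply: le_trans (dot_le _ _) _.
  by rewrite ler_wpM2l// ler_pM//; apply/ltW/h3.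
have t2 : - ((wb * k - w0 * k0) * ((a.1 - b.1) * A)) <= S1 * e1 * (N * `|A|).
  apply: le_trans (ler_norm _) _; rewrite normrN normrM ler_pM//.
  by rewrite normrM ler_wpM2r.
have t3 : - (wb * k * rho) <= (w0 * k0 + S1) * (e1 * N).
  by apply: le_trans (ler_norm _) _; rewrite normrN normrM ler_pM.
apply: (@le_trans _ _ (e1 * S * N)); last by rewrite ler_wpM2r.
rewrite dotBr in t1; rewrite /pol_diff/= -/y0 -/w0 -/k0 -/A /S; lra.
Qed.

(** [pol_increment] is one-sided, but it also holds with [a] and [b] exchanged; as [pol_diff] is
    linear, the two bounds control the absolute value. *)
Lemma sdiff_pol p : spacetime p -> sdiff spacetime (unc W) p (pol_diff p.1 p.2).
Proof.
move=> Dp; have bL := blin_pol_diff p.1 p.2; split => // e e0.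
have [d d0 hd] := pol_increment Dp e0; exists d => // a b Da Db ap bp.
have A := hd a b Da Db ap bp; have B := hd b a Db Da bp ap.
rewrite ler_norml /unc A andbT; move: B; rewrite (distrC b) (blinB b a bL).
by rewrite (blinB a b bL); lra.
Qed.

Lemma C1_pol : C1_spacetime W.
Proof.
by apply: sdiff_C1 => p Dp; exists (pol_diff p.1 p.2); exact: sdiff_pol.
Qed.

Lemma good_pol_family t : 0 <= t -> good (W t).
Proof. by move=> t0; apply: good_pol (gH t0) _; exact: C1_slice C1_pol t0. Qed.

Lemma dt_pol t x : 0 <= t -> x != 0 ->
  dt W t x = - (W t x * (H t (Y t x))^-1 * dt H t (Y t x)).
Proof.
move=> t0 x0; have Dp : spacetime (t, x) by [].
by rewrite (sdiff_dt (sdiff_pol Dp)) /pol_diff/= dot0l mul1r sub0r.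
Qed.

Lemma grad_pol t x : 0 <= t -> x != 0 ->
  grad (W t) x = (H t (Y t x))^-1 *: Y t x.
Proof.
move=> t0 x0; have C1W := C1_slice C1_pol t0.
have c := contact_sym (gH t0) (touchP (gH t0) x0).
have h0 : H t (Y t x) != 0.
  by rewrite gt_eqF// (good_gt0 (gH t0))// (touch_neq0 (gH t0)).
apply: (scalerI h0); rewrite scalerA divff// scale1r.
exact/esym/(contact_grad C1W x0 c).
Qed.

End Family.

(** * The polar of a family: second derivatives *)

Section SecondOrder.
Context {R : realType} {n : nat}.
Local Notation V := 'rV[R]_n.
Local Notation E := (R * V)%type.

Lemma blin_mulmx (B : 'M[R]_n) : blin (fun v : V => v *m B).
Proof.
have -> : (fun v : V => v *m B) = (fun v => \row_i dot v (\row_j B j i)).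
  apply/funext => v; apply/rowP => i; rewrite !mxE.
  by apply: eq_bigr => j _; rewrite mxE.
by apply: (blin_row (L := fun i v => dot v (\row_j B j i))) => i; exact: blin_dotl.
Qed.

Lemma pos_def_unitmx (A : 'M[R]_n) : pos_def A -> A \in unitmx.
Proof.
move=> pA; rewrite -row_free_unit; apply: inj_row_free => v vA.
apply/eqP/negPn/negP => /pA; by rewrite vA dot0l ltxx.
Qed.

Definition grad_diff (F : R -> V -> R) (t : R) (x : V) (v : E) : V :=
  \row_i C1_diff (dx i F) t x v.

Lemma sdiff_grad_spacetime F t x : C2_spacetime F -> 0 <= t -> x != 0 ->
  sdiff spacetime (fun q : E => grad (F q.1) q.2) (t, x) (grad_diff F t x).
Proof.
move=> [_ _ C1dx] t0 x0.
by apply: (sdiff_row (F := fun i => unc (dx i F))) => // i; exact: C1_sdiff.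
Qed.

Lemma grad_diff_space F t x v : grad_diff F t x (0, v) = v *m hessian (F t) x.
Proof.
apply/rowP => i; rewrite !mxE /C1_diff/= mul0r add0r.
by apply: eq_bigr => j _; rewrite !mxE.
Qed.

(* Implicit differentiation, with the derivative of G in the second variable
   inverted by B. *)
Lemma sdiff_implicit (G : E -> V) (y : E -> V) (Q : E -> V) (p : E)
    (LG LQ : E -> V) (A B : 'M[R]_n) :
  (forall q, spacetime q -> spacetime (q.1, y q)) ->
  y @ within spacetime (nbhs p) --> y p ->
  (forall q, spacetime q -> G (q.1, y q) = Q q) ->
  sdiff spacetime G (p.1, y p) LG -> sdiff spacetime Q p LQ ->
  (forall v, LG (0, v) = v *m A) -> A *m B = 1%:M ->
  sdiff spacetime y p (fun v => (LQ v - LG (v.1, 0)) *m B).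
Proof.
move=> Dy cy GQ dG dQ LGA AB; have [_ bG hG] := dG; have [Dp bQ hQ] := dQ.
have bB := blin_mulmx B.
have bL : blin (fun v : E => (LQ v - LG (v.1, 0)) *m B).
  apply: (blin_comp (L := fun v : E => LQ v - LG (v.1, 0)) _ bB).
  have -> : (fun v : E => LQ v - LG (v.1, 0)) =
      (fun v => LQ v + (-1) *: LG (v.1, 0)) by apply/funext => v; rewrite scaleN1r.
  apply: blin_add => //; apply: (blin_scale (L := fun v : E => LG (v.1, 0))).
  apply: (blin_comp (L := fun v : E => (v.1, 0 : V)) _ bG).
  by apply: (blin_pair (L := fst)); [exact: blin_fst|exact: blin_cst0].
have [_ [CB CB0 hB]] := bB; have [_ [CL CL0 hL]] := bL.
split=> // e e0.
pose S := CB * (4 + 2 * CL) + 1; have S0 : 0 < S.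
  by rewrite ltr_wpDl// mulr_ge0// addr_ge0// mulr_ge0.
pose e1 := Num.min (e / S) (2 * (CB + 1))^-1.
have C10 : 0 < CB + 1 by rewrite ltr_wpDl.
have e10 : 0 < e1 by rewrite lt_min divr_gt0//= invr_gt0 mulr_gt0.
have e1S : e1 * S <= e by rewrite -ler_pdivlMr// ge_min lexx.
have e1B : e1 * CB <= 1 / 2.
  apply: (@le_trans _ _ (e1 * (CB + 1))); first by rewrite ler_pM2l// lerDl.
  rewrite -ler_pdivlMr// ge_min; apply/orP; right.
  by rewrite invfM div1r.
have [d1 d10 h1] := hG _ e10; have [d2 d20 h2] := hQ _ e10.
have /(@within_cvgP R E V)/(_ _ d10)[d3 d30 h3] := cy.
exists (Num.min (Num.min d1 d2) d3); first by rewrite !lt_min d10 d20.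
move=> a b Da Db; rewrite !lt_min -!andbA => /and3P[a1 a2 a3] /and3P[b1 b2 b3].
have near c : spacetime c -> `|c - p| < d1 -> `|c - p| < d3 ->
    `|(c.1, y c) - (p.1, y p)| < d1.
  move=> Dc c1 c3; rewrite prod_normE/= gt_max h3// andbT.
  exact: le_lt_trans (norm_fst_le (c - p)) c1.
have := h1 _ _ (Dy a Da) (Dy b Db) (near a Da a1 a3) (near b Db b1 b3).
have := h2 a b Da Db a2 b2; rewrite !GQ//.
set N := `|a - b|; set v := a - b; set dy := y a - y b; set dq := Q a - Q b => A2 A1.
(* [B] inverts the part of [LG] that acts on [dy], so the error is the image under [B] of the
   linearization errors of [Q] and [G]. *)
have E0 : dy - (LQ v - LG (v.1, 0)) *m B =
    ((dq - LQ v) - (dq - LG (v.1, dy))) *m B.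
  have -> : (v.1, dy) = (v.1, 0 : V) + (0, dy).
    by congr pair; rewrite /= ?addr0 ?add0r.
  rewrite (blinD _ _ bG) LGA; set l := LG (v.1, 0); set q := LQ v.
  have -> : dq - q - (dq - (l + dy *m A)) = dy *m A - (q - l).
    by rewrite (opprB dq) (opprB q) [LHS]addrC subrKA -addrA addrCA.
  by rewrite [RHS]mulmxBl -mulmxA AB mulmx1.
have ht : `|v.1| <= N := norm_fst_le v.
have N0 : 0 <= N by rewrite normr_ge0.
have ndy : Num.max `|v.1| `|dy| <= N + `|dy|.
  by rewrite ge_max lerDr N0 andbT (le_trans ht)// lerDl.
have {}A1 : `|dq - LG (v.1, dy)| <= e1 * (N + `|dy|).
  by rewrite (le_trans A1)// prod_normE/= ler_wpM2l// ltW.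
have A3 : `|((dq - LQ v) - (dq - LG (v.1, dy))) *m B| <= CB * (e1 * (2 * N + `|dy|)).
  rewrite (le_trans (hB _))// ler_wpM2l// (le_trans (ler_normB _ _))//.
  by rewrite (le_trans (lerD A2 A1))//; lra.
rewrite E0 (le_trans A3)//.
have := hL v; rewrite -/N => A4.
(* [e1 * CB <= 1 / 2] absorbs the norm of [dy] on the right. This makes [y] Lipschitz near [p], so
   that the error is of order [N]. *)
have hdy : `|dy| <= 2 * ((CL + 1) * N).
  have : `|dy| <= CL * N + CB * (e1 * (2 * N + `|dy|)).
    rewrite -(subrK ((LQ v - LG (v.1, 0)) *m B) dy) (le_trans (ler_normD _ _))//.
    rewrite addrC subrK lerD// E0.
    exact: A3.
  have := ler_wpM2r N0 e1B; have := ler_wpM2r (normr_ge0 dy) e1B; lra.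
apply: (@le_trans _ _ (CB * (e1 * (2 * N + 2 * ((CL + 1) * N))))).
  by rewrite ler_wpM2l// ler_wpM2l ?(ltW e10)// lerD2l.
apply: (@le_trans _ _ (e1 * S * N)); last by rewrite ler_wpM2r.
have : 0 <= e1 * N by rewrite mulr_ge0// ltW.
rewrite /S; lra.
Qed.

Variable H : R -> V -> R.
Hypothesis gH : forall t, 0 <= t -> good (H t).
Hypothesis C2H : C2_spacetime H.
Hypothesis pdH : forall t x, 0 <= t -> x != 0 -> pos_def (hessian (H t) x).

Let C1H : C1_spacetime H. Proof. by case: C2H. Qed.
Let W t x := pol (H t) x.
Let Y t x := touch (H t) x.
Let Yu (q : E) := Y q.1 q.2.

Let DY (q : E) : spacetime q -> spacetime (q.1, Yu q).
Proof. by move=> [q1 q2]; split => //; exact: (touch_neq0 (gH q1)). Qed.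

Definition slope_diff (p v : E) : V :=
  (- (W p.1 p.2) ^- 2 *: pol_diff H p.1 p.2 v) *: p.2 + (W p.1 p.2)^-1 *: v.2.

Lemma sdiff_slope p : spacetime p ->
  sdiff spacetime (fun q => (W q.1 q.2)^-1 *: q.2) p (slope_diff p).
Proof.
move=> Dp; have W0 : W p.1 p.2 != 0.
  by rewrite gt_eqF// (pol_gt0 (gH Dp.1))// Dp.2.
have dW : sdiff spacetime (fun q => W q.1 q.2) p (pol_diff H p.1 p.2).
  exact: sdiff_pol.
exact: (sdiff_scale (sdiff_inv (F := fun q : E => W q.1 q.2) W0 dW)
  (sdiff_blin Dp blin_snd)).
Qed.

Definition touch_diff (p v : E) : V :=
  (slope_diff p v - grad_diff H p.1 (Yu p) (v.1, 0)) *m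
  invmx (hessian (H p.1) (Yu p)).

Lemma sdiff_touch p : spacetime p -> sdiff spacetime Yu p (touch_diff p).
Proof.
move=> Dp; have [DY1 DY2] := DY Dp; have [p1 p2] := Dp.
apply: (sdiff_implicit (G := fun q => grad (H q.1) q.2) (LG := grad_diff H p.1 (Yu p))
  (Q := fun q => (W q.1 q.2)^-1 *: q.2) (A := hessian (H p.1) (Yu p))).
- exact: DY.
- exact: (Y_cvg gH C1H Dp).
- move=> q Dq; have [q1 q2] := Dq; have [_ y0] := DY Dq.
  have [_ _ _ C1q _] := gH q1.
  have W0 : W q.1 q.2 != 0 by rewrite gt_eqF// (pol_gt0 (gH q1)).
  have xE := contact_grad C1q y0 (touchP (gH q1) q2).
  by apply: (scalerI W0); rewrite scalerA divff// scale1r; exact/esym.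
- exact: sdiff_grad_spacetime.
- exact: sdiff_slope.
- exact: grad_diff_space.
- by apply: mulmxV; apply: pos_def_unitmx; exact: pdH.
Qed.

Lemma touch_diff_space p v : spacetime p ->
  touch_diff p (0, v) *m hessian (H p.1) (Yu p) = slope_diff p (0, v).
Proof.
move=> Dp; have [_ y0] := DY Dp.
rewrite /touch_diff/= grad_diff_space mul0mx subr0 mulmxKV//.
by apply: pos_def_unitmx; apply: pdH => //; exact: Dp.1.
Qed.

Lemma sdiff_along (F : R -> V -> R) p : C1_spacetime F -> spacetime p ->
  sdiff spacetime (fun q : E => F q.1 (Yu q)) p
    (fun v => C1_diff F p.1 (Yu p) (v.1, touch_diff p v)).
Proof.
move=> C1F Dp; have [DY1 DY2] := DY Dp.
apply: (sdiff_comp (F := fun q => (q.1, Yu q)) (K := unc F) (D' := spacetime)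
  (L := fun v => (v.1, touch_diff p v))).
- exact: DY.
- apply: sdiff_pair; last exact: sdiff_touch.
  by apply: sdiff_blin => //; exact: blin_fst.
- exact: C1_sdiff.
Qed.

Let HY0 p : spacetime p -> H p.1 (Yu p) != 0.
Proof.
by move=> Dp; have [q1 q2] := DY Dp; rewrite gt_eqF// (good_gt0 (gH q1)).
Qed.

Definition gradpol_diff (p v : E) : V :=
  (- (H p.1 (Yu p)) ^- 2 *: C1_diff H p.1 (Yu p) (v.1, touch_diff p v)) *: Yu p +
  (H p.1 (Yu p))^-1 *: touch_diff p v.

Lemma sdiff_gradpol p : spacetime p ->
  sdiff spacetime (fun q => (H q.1 (Yu q))^-1 *: Yu q) p (gradpol_diff p).
Proof.
move=> Dp; apply: sdiff_scale; last exact: sdiff_touch.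
exact: (sdiff_inv (F := fun q : E => H q.1 (Yu q)) (HY0 Dp) (sdiff_along C1H Dp)).
Qed.

Let sdiff_dx_pol p i : spacetime p ->
  sdiff spacetime (unc (dx i W)) p (fun v => gradpol_diff p v 0 i).
Proof.
move=> Dp; apply: (eq_sdiff _ (sdiff_coord i (sdiff_gradpol Dp))).
by move=> [t x] [/= t0 x0]; rewrite /unc/= /dx -(grad_pol gH C1H t0 x0) mxE.
Qed.

(** [dt W] and [grad W] are explicit in [W], [Y] and in [H], [dt H] along [Y], all strictly
    differentiable once [Y] is. *)
Lemma C2_pol : C2_spacetime W.
Proof.
split; first exact: C1_pol.
  apply: sdiff_C1 => p Dp.
  have dW := sdiff_pol gH C1H Dp.
  have dk := sdiff_inv (F := fun q : E => H q.1 (Yu q)) (HY0 Dp)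
    (sdiff_along C1H Dp).
  have C1dt : C1_spacetime (dt H) by case: C2H.
  have dA := sdiff_along C1dt Dp.
  eexists; apply: eq_sdiff; last first.
    exact: (sdiff_scale (sdiff_cst (-1 : R) Dp) (sdiff_scale (sdiff_scale dW dk) dA)).
  move=> [t x] [/= t0 x0]; rewrite /unc/= (dt_pol gH C1H t0 x0).
  by rewrite [(-1) *: _]mulN1r.
by move=> i; apply: sdiff_C1 => p Dp; eexists; exact: sdiff_dx_pol.
Qed.

(** Let [dy] be the derivative of the contact point in the direction [v]. Differentiating the
    contact relations expresses the quadratic form of the polar at [v] as [h^-1 * w] times that of
    [H t] at [dy]. *)
Lemma pos_def_pol t x : 0 <= t -> x != 0 -> pos_def (hessian (W t) x).
Proof.
move=> t0 x0 v v0; have Dp : spacetime (t, x) by [].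
have -> : v *m hessian (W t) x = gradpol_diff (t, x) (0, v).
  rewrite -grad_diff_space; apply/rowP => i; rewrite mxE.
  by rewrite -(sdiff_C1_diff (sdiff_dx_pol i Dp)).
have [_ y0] := DY Dp; have c := touchP (gH t0) x0.
have [_ _ _ C1h _] := gH t0.
rewrite /= in y0; set y := Yu (t, x) in y0; rewrite -/(Yu (t, x)) -/y in c.
have h0 : 0 < H t y := good_gt0 (gH t0) y0.
have w0 : 0 < W t x := pol_gt0 (gH t0) x0.
have xg := contact_grad C1h y0 c; have [xy _] := c.
have Q := touch_diff_space v Dp.
set dy := touch_diff (t, x) (0, v) in Q.
set h := H t y in h0 xy; set w := W t x in w0 xg xy.
rewrite /= in Q.
have Wv : pol_diff H t x (0, v) * h = dot v y.
  rewrite /pol_diff/= mul0r subr0 dotZr -/(Y t x) -[Y t x]/y -/h.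
  by rewrite mulrC mulrA divff ?mul1r// gt_eqF.
have hv : C1_diff H t y (0, dy) * w = dot dy x.
  by rewrite /C1_diff/= mul0r add0r xg dotZr mulrC.
set dW := pol_diff H t x (0, v) in Wv.
set dh := C1_diff H t y (0, dy) in hv.
have QE : slope_diff (t, x) (0, v) = (- w ^- 2 * dW) *: x + w^-1 *: v by [].
rewrite {}QE in Q.
have -> : gradpol_diff (t, x) (0, v) = (- h ^- 2 * dh) *: y + h^-1 *: dy by [].
(* If [dy = 0], then [v] is a multiple of [x], and the normalization [dot x y = 1 + w * h] forces
   this multiple to be 0. *)
have dy0 : dy != 0.
  apply/eqP => e; move: Q; rewrite e mul0mx => /esym/eqP.
  rewrite addrC addr_eq0 => /eqP vE.
  have {}vE : v = (w^-1 * dW) *: x.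
    apply: (scalerI (invr_neq0 (lt0r_neq0 w0))).
    rewrite vE -scaleNr scalerA; congr (_ *: _).
    by rewrite /GRing.scale/=; field; rewrite gt_eqF.
  have : w^-1 * dW = 0.
    have := Wv; rewrite {1}vE dotZl xy.
    have -> : w^-1 * dW * (1 + w * h) = w^-1 * dW + dW * h.
      by field; rewrite gt_eqF.
    lra.
  by move=> e'; move: v0; rewrite vE e' scale0r eqxx.
have pd := pdH t0 y0 dy0; rewrite -/y {}Q in pd.
have -> : dot ((- h ^- 2 * dh) *: y + h^-1 *: dy) v =
    h^-1 * w * dot ((- w ^- 2 * dW) *: x + w^-1 *: v) dy.
  rewrite !dotDl !dotZl (dotC y v) -Wv (dotC x dy) -hv (dotC v dy).
  by field; rewrite !gt_eqF.
by rewrite mulr_gt0// mulr_gt0// invr_gt0.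
Qed.

End SecondOrder.

(** * The family f^polar + t g *)

Section Affine.
Context {R : realType} {n : nat}.
Local Notation V := 'rV[R]_n.
Local Notation E := (R * V)%type.
Implicit Types (F K : R -> V -> R) (h g : V -> R).

Lemma eq_dt F K t x : (forall t x, 0 <= t -> x != 0 -> F t x = K t x) ->
  C1_spacetime K -> 0 <= t -> x != 0 -> dt F t x = dt K t x.
Proof.
move=> FK C1K t0 x0; have dK := C1_sdiff C1K t0 x0.
rewrite (sdiff_dt dK); apply: sdiff_dt; apply: eq_sdiff dK.
by move=> [s y] [/= s0 y0]; rewrite /unc/= FK.
Qed.

Lemma eq_dx F K t x i : (forall t x, 0 <= t -> x != 0 -> F t x = K t x) ->
  C1_spacetime K -> 0 <= t -> x != 0 -> dx i F t x = dx i K t x.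
Proof.
move=> FK C1K t0 x0; have dK := C1_sdiff C1K t0 x0.
rewrite /dx (sdiff_partial dK); apply: sdiff_partial; apply: eq_sdiff dK.
by move=> [s y] [/= s0 y0]; rewrite /unc/= FK.
Qed.

Lemma eq_C2_spacetime F K : (forall t x, 0 <= t -> x != 0 -> F t x = K t x) ->
  C2_spacetime K -> C2_spacetime F.
Proof.
move=> FK [C1K C1dtK C1dxK]; split.
- by apply: eq_C1_spacetime C1K => t x t0 x0; rewrite FK.
- by apply: eq_C1_spacetime C1dtK => t x t0 x0; rewrite (eq_dt FK).
- by move=> i; apply: eq_C1_spacetime (C1dxK i) => t x t0 x0; rewrite (eq_dx _ FK).
Qed.

Definition affine h g : R -> V -> R := fun t x => h x + t * g x.

Section C1Affine.
Variables h g : V -> R.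
Hypotheses (C1h : C1_off0 h) (C1g : C1_off0 g).

Lemma sdiff_affine t x : 0 <= t -> x != 0 ->
  sdiff spacetime (unc (affine h g)) (t, x) (fun v : E =>
    C1_diff (fun=> h) t x v + (v.1 *: g x + t *: C1_diff (fun=> g) t x v)).
Proof.
move=> t0 x0; have dh := C1_sdiff (C1_static C1h) t0 x0.
have dg := C1_sdiff (C1_static C1g) t0 x0.
have dt : sdiff spacetime (fst : E -> R) (t, x) fst.
  by apply: sdiff_blin => //; exact: blin_fst.
exact: (sdiff_add dh (sdiff_scale dt dg)).
Qed.

Lemma C1_affine : C1_spacetime (affine h g).
Proof. by apply: sdiff_C1 => -[t x] [/= t0 x0]; eexists; exact: sdiff_affine. Qed.

Lemma dt_affine t x : 0 <= t -> x != 0 -> dt (affine h g) t x = g x.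
Proof.
move=> t0 x0; rewrite (sdiff_dt (sdiff_affine t0 x0)) /C1_diff/= !dt_cst//.
by rewrite !dot0l !mulr0 !addr0 scaler0 addr0 add0r scale1r.
Qed.

Lemma dx_affine t x i : 0 <= t -> x != 0 ->
  dx i (affine h g) t x = affine (partial i h) (partial i g) t x.
Proof.
move=> t0 x0; rewrite /dx (sdiff_partial (sdiff_affine t0 x0)) /C1_diff/=.
by rewrite !mul0r !add0r scale0r add0r !dot_basis !mxE.
Qed.

Lemma grad_affine t x : 0 <= t -> x != 0 ->
  grad (affine h g t) x = grad h x + t *: grad g x.
Proof.
by move=> t0 x0; apply/rowP => i; rewrite !mxE; exact: dx_affine.
Qed.

Lemma itc_affine t x : 0 <= t -> x != 0 ->
  itc (affine h g t) x = itc h x + t * itc g x.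
Proof.
by move=> t0 x0; rewrite /itc grad_affine// dotDr dotZr /affine; ring.
Qed.

End C1Affine.

Lemma C2_affine h g : C2_off0 h -> C2_off0 g -> C2_spacetime (affine h g).
Proof.
move=> [C1h C1dh] [C1g C1dg]; split; first exact: C1_affine.
  apply: eq_C1_spacetime (C1_static C1g) => t x t0 x0.
  by rewrite dt_affine.
move=> i; apply: eq_C1_spacetime (C1_affine (C1dh i) (C1dg i)) => t x t0 x0.
by rewrite dx_affine.
Qed.

Lemma hessian_affine h g t x : C2_off0 h -> C2_off0 g -> 0 <= t -> x != 0 ->
  hessian (affine h g t) x = hessian h x + t *: hessian g x.
Proof.
move=> [C1h C1dh] [C1g C1dg] t0 x0; apply/matrixP => i j; rewrite !mxE.
have := @eq_dx (dx j (affine h g)) (affine (partial j h) (partial j g)) t x i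
  (fun t x t0 x0 => dx_affine C1h C1g j t0 x0) (C1_affine (C1dh j) (C1dg j)) t0 x0.
by move=> e; exact: etrans e (dx_affine (C1dh j) (C1dg j) i t0 x0).
Qed.

Lemma C2_static h : C2_off0 h -> C2_spacetime (fun=> h).
Proof.
move=> [C1h C1dh]; split; first exact: C1_static.
  apply: sdiff_C1 => -[t x] Dp; exists (fun=> 0).
  apply: (eq_sdiff _ (sdiff_cst (0 : R) Dp)) => -[s y] [/= s0 y0].
  by rewrite /unc/= dt_cst.
by move=> i; exact: C1_static (C1dh i).
Qed.

(** Two tangent inequalities make the gradient of a convex function monotone; the quadratic form is
    the limit of [h^-1] times its increment along [h *: v], paired with [v]. *)
Lemma hessian_ge0 g x v : cvx g -> C2_off0 g -> x != 0 ->
  0 <= dot (v *m hessian g x) v.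
Proof.
move=> cg [C1g C1dg] x0; have [->|v0] := eqVneq v 0; first by rewrite mul0mx dot0l.
have cvgs : \sum_i (h^-1 *: ((partial i g \o shift x) (h *: v) - partial i g x)) * v 0 i
    @[h --> (0 : R)^'+] --> dot (v *m hessian g x) v.
  apply: cvg_rsum => i; apply: cvgM; last exact: cvg_cst.
  have := derive_cvg (v := v) (C1dg i) x0 => /cvg_dnbhs_at_right.
  suff -> : dot v (grad (partial i g) x) = (v *m hessian g x) 0 i by [].
  by rewrite mxE; apply: eq_bigr => j _; rewrite !mxE.
apply: (cvgr_to_ge cvgs); near=> h.
have h0 : 0 < h by near: h; exact: nbhs_right_gt.
have y0 : h *: v + x != 0.
  have : h * `|v| < `|x|.
    rewrite -ltr_pdivlMr ?normr_gt0//; near: h; apply: nbhs_right_lt.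
    by rewrite divr_gt0 ?normr_gt0.
  apply: contraTneq => /eqP; rewrite addr_eq0 => /eqP e.
  by rewrite -[x]opprK -e normrN normrZ gtr0_norm// ltxx.
have := tangent_le x cg C1g y0; have := tangent_le (h *: v + x) cg C1g x0.
rewrite /itc !dotDl !dotZl => A B.
have -> : \sum_i h^-1 *: ((partial i g \o shift x) (h *: v) - partial i g x) * v 0 i
    = h^-1 * (dot v (grad g (h *: v + x)) - dot v (grad g x)).
  rewrite -sumrB mulr_sumr; apply: eq_bigr => i _.
  rewrite !mxE /shift/=; set a := partial i g _.
  by rewrite /GRing.scale/=; ring.
rewrite mulr_ge0 ?invr_ge0 ?(ltW h0)// -(pmulr_rge0 _ h0) mulrBr; lra.
Unshelve. all: by end_near. Qed.

Section GoodAffine.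
Variables h g : V -> R.
Hypotheses (gh : good h) (cg : cvx g) (g0 : g 0 = 0) (gp : forall x, 0 <= g x).

(** Intercepts add, and those of [g] are nonnegative, so the sum inherits unbounded intercepts on
    rays from [h]. *)
Lemma good_affine t : C1_off0 g -> 0 <= t -> good (affine h g t).
Proof.
move=> C1g t0; have [h0 hp sh C1h nh] := gh.
have sH : scvx (affine h g t).
  move=> x y s xy s01; rewrite /affine.
  have := sh x y s xy s01; have /andP[s0 s1] := s01.
  have := cg x y (t := s); rewrite (ltW s0) (ltW s1) => /(_ isT)/(ler_wpM2l t0); lra.
have C1H : C1_off0 (affine h g t) by exact: C1_slice (C1_affine C1h C1g) t0.
split => //.
- by rewrite /affine h0 g0 mulr0 addr0.
- by move=> x; rewrite /affine addr_ge0// mulr_ge0.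
apply: itc_nonlin => //; first exact: scvx_cvx.
move=> x M x0; have [s s0 hs] := nonlin_itc M (scvx_cvx sh) C1h h0 hp nh x0.
exists s => //; have sx0 : s *: x != 0 by rewrite scaler_eq0 negb_or gt_eqF.
rewrite itc_affine// (lt_le_trans hs)// lerDl mulr_ge0//.
by have := tangent_le 0 cg C1g sx0; rewrite dot0l g0 subr0.
Qed.

Lemma pos_def_affine t x : C2_off0 h -> C2_off0 g -> pos_def (hessian h x) ->
  0 <= t -> x != 0 -> pos_def (hessian (affine h g t) x).
Proof.
move=> C2h C2g pd t0 x0 v v0; rewrite hessian_affine// mulmxDr dotDl.
by rewrite -scalemxAr dotZl ltr_pwDl ?pd// mulr_ge0// hessian_ge0.
Qed.

End GoodAffine.
End Affine.

(** * Passage between extended and real values; a bipolar theorem for g *)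

Section Ereal.
Context {R : realType} {n : nat}.
Local Notation V := 'rV[R]_n.

Lemma Cvx0_cvx (f : V -> \bar R) : Cvx0 f -> (forall x, f x \is a fin_num) ->
  [/\ f = EFin \o (fine \o f), cvx (fine \o f), fine (f 0) = 0 &
      forall x, 0 <= fine (f x)].
Proof.
move=> [f0 cf _ fz] ff; have fE x : f x = (fine (f x))%:E by rewrite fineK.
split.
- by apply/funext => x /=; rewrite -fE.
- move=> x y t t01; have := cf x y t t01.
  by rewrite (fE x) (fE y) (fE (_ + _)) -!EFinM -EFinD lee_fin.
- by rewrite fz.
- by move=> x; exact: fine_ge0.
Qed.

Lemma S2_good (f : V -> \bar R) : S2 f -> nonlinear_at_infinity f ->
  good (fine \o f).
Proof.
move=> [[Cf ff C1f sf] _ _] nf; have fE x : f x = (fine (f x))%:E by rewrite fineK.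
have [_ _ f0 fp] := Cvx0_cvx Cf ff.
split => //.
  move=> x y t xy t01; have := sf x y t xy t01.
  by rewrite (fE x) (fE y) (fE (_ + _)%R) -!EFinM -EFinD lte_fin.
move=> x x0 [a [b [a0 b0 ab]]]; have [_] := nf x x0; apply; exists a, b.
split => // t t0; have /andP[A B] := ab t t0.
by rewrite fE !lee_fin.
Qed.

Lemma good_S2 (phi : V -> R) : good phi -> C2_off0 phi ->
  (forall x, x != 0 -> pos_def (hessian phi x)) ->
  S2 (EFin \o phi) /\ nonlinear_at_infinity (EFin \o phi).
Proof.
move=> gp C2p pd; have [p0 pp sp C1p np] := gp.
split; last first.
  move=> x x0; split=> // -[a [b [a0 b0 ab]]]; apply: (np x x0); exists a, b.
  by split => // t t0; have [] := ab t t0; rewrite !lee_fin => -> ->.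
split => //; split => //.
  split.
  - by move=> x; rewrite lee_fin.
  - move=> x y t t01; rewrite /= -!EFinM -EFinD lee_fin.
    exact: scvx_cvx.
  - move=> x a; rewrite lte_fin => ax.
    (* [C1_off0] gives no continuity at 0; there lower semicontinuity holds because 0 is the minimum
       value. *)
    have [x0|x0] := eqVneq x 0.
      exists setT; first exact: filterT.
      by move=> y _; rewrite lte_fin (lt_le_trans ax)// x0 p0.
    have /(@nbhs_cvgP R V) := C1_off0_cvg C1p x0.
    move=> /(_ (phi x - a)); rewrite subr_gt0 => /(_ ax)[d d0 hd].
    exists (ball x d); first exact: nbhsx_ballx.
    move=> y; rewrite -ball_normE/= distrC => /hd.
    by rewrite ltr_distl lte_fin => /andP[+ _]; lra.
  - by rewrite /= p0.
Qed.

(* Bipolar theorem for a finite g that may vanish off 0 or be linear along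
   rays, hence the case distinction on the intercept of its tangents. *)
Lemma polar_scale_polar (g : V -> R) (t : R) y : cvx g -> C1_off0 g -> g 0 = 0 ->
  (forall x, 0 <= g x) -> 0 < t ->
  polar (fun x => (t^-1)%:E * polar (EFin \o g) x)%E y = (t * g y)%:E.
Proof.
move=> cg C1g g0 gp t0; have ti0 : 0 < t^-1 by rewrite invr_gt0.
have pol_ge0 x : (0 <= polar (EFin \o g) x)%E.
  by apply: le_ereal_inf_tmp => _ [c [c0 _] <-]; rewrite lee_fin.
have tight x r : polar (EFin \o g) x = r%:E -> forall z, dot z x <= 1 + r * g z.
  move=> rE z; apply/ler_addgt0Pr => e e0.
  have e1 : 0 < e / (g z + 1) by rewrite divr_gt0// ltr_wpDl.
  have [|_ [c [c0 hc] <-]] := lb_ereal_inf_adherent e1 (S := [set c%:E | c in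
    [set c : R | 0 <= c /\ forall z, ((dot z x)%:E <= 1%:E + c%:E * (EFin \o g) z)%E]]).
    by rewrite -/(polar _ _) rE.
  rewrite -/(polar _ _) rE -EFinD lte_fin => cr.
  have := hc z; rewrite /= -EFinM -EFinD lee_fin => /le_trans; apply.
  rewrite -addrA lerD2l; apply: (@le_trans _ _ ((r + e / (g z + 1)) * g z)).
    by rewrite ler_wpM2r// ltW.
  rewrite mulrDl lerD2l -mulrA ler_piMr ?ltW// mulrC ltr_pdivrMr ?ltr_wpDl//.
  by rewrite mul1r ltrDl.
apply/eqP; rewrite eq_le; apply/andP; split.
  (* The slack [e] makes the coefficient positive: where the polar of [g] is infinite, a coefficient
     0 would give the product 0, and the bound could fail. *)
  apply/lee_addgt0Pr => e e0; apply: ereal_inf_lbound.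
  have tg0 : 0 <= t * g y by rewrite mulr_ge0// ltW.
  have c0 : 0 < t * g y + e by rewrite ltr_wpDl.
  exists (t * g y + e); last by rewrite EFinD.
  split; first exact: ltW.
  move=> x; have := pol_ge0 x; case Ex : (polar _ x) => [r| |] //.
    rewrite lee_fin => r0; rewrite -!EFinM -EFinD lee_fin dotC.
    rewrite dotC (le_trans _ (_ : 1 + r * g y <= _))//.
      by rewrite dotC; exact: tight.
    rewrite lerD2l (_ : _ * (t^-1 * r) = (g y + e * t^-1) * r); last first.
      by field; rewrite gt_eqF.
    by rewrite mulrC ler_wpM2r// lerDl mulr_ge0// ltW.
  by move=> _; rewrite gt0_muley ?lte_fin// gt0_muley ?lte_fin// addey ?leey.
apply: le_ereal_inf_tmp => _ [c [c0 hc] <-]; rewrite lee_fin.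
have [->|y0] := eqVneq y 0; first by rewrite g0 mulr0.
have s0 : 0 <= itc g y by have := tangent_le 0 cg C1g y0; rewrite dot0l g0 subr0.
set p := grad g y; set s := itc g y in s0.
(* The test points are multiples of the gradient at [y]; [l * s <= 1] makes [l] admissible in the
   polar of [g] at [l *: p]. *)
have key l : 0 < l -> l * s <= 1 -> l * (g y + s) <= 1 + c * t^-1 * l.
  move=> l0 ls; have pl : (polar (EFin \o g) (l *: p) <= l%:E)%E.
    apply: ereal_inf_lbound; exists l => //; split; first exact: ltW.
    move=> z; rewrite /= -EFinM -EFinD lee_fin dotZr.
    have := ler_wpM2l (ltW l0) (tangent_le z cg C1g y0); rewrite mulrBr -/p -/s; lra.
  have := hc (l *: p); rewrite dotZl dotC.
  have -> : dot y p = g y + s by rewrite /s /itc -/p; ring.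
  move: pl; have := pol_ge0 (l *: p); case: (polar _ _) => [r| |] //.
  rewrite -!EFinM -EFinD !lee_fin => r0 rl /le_trans; apply.
  by rewrite lerD2l -mulrA ler_wpM2l// ler_wpM2l// ltW.
suff : g y <= c * t^-1 by rewrite ler_pdivlMr// mulrC.
(* For [s = 0] every positive [l] is allowed, and [l = e^-1] gives the bound up to [e]; for [s > 0]
   the largest [l = s^-1] gives it exactly. *)
move: s0; rewrite le_eqVlt => /orP[/eqP s0|s0].
  apply/ler_addgt0Pr => e e0; have ei : 0 < e^-1 by rewrite invr_gt0.
  have := key e^-1 ei; rewrite -s0 mulr0 addr0 => /(_ ler01).
  rewrite -(ler_pM2l e0) mulrA divff ?gt_eqF// mul1r mulrDr mulr1.
  by rewrite (mulrC e) divfK ?gt_eqF// addrC.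
have si : 0 < s^-1 by rewrite invr_gt0.
have := key s^-1 si; rewrite mulVf ?gt_eqF// => /(_ (lexx _)).
rewrite mulrDr mulVf ?gt_eqF// addrC lerD2l mulrC ler_pM2r//.
Qed.

End Ereal.

Theorem theorem6p1 (R : realType) (n : nat) (g f : 'rV[R]_n -> \bar R)
    (hg : Cvx0 g) (hg2 : eC2_off0 g)
    (hf : S2 f) (hfinf : nonlinear_at_infinity f) :
  is_solution g f (flow f g) /\
  forall u : R -> 'rV[R]_n -> \bar R, is_solution g f u ->
    forall (t : R) (x : 'rV[R]_n), 0 <= t -> u t x = flow f g t x.
Proof.
have gfin x : g x \is a fin_num.
  by have [->|/hg2.1//] := eqVneq x 0; have [_ _ _ ->] := hg.
pose G := fine \o g; pose F := fine \o f.
have [gE cG G0 Gp] := Cvx0_cvx hg gfin.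
have gF : good F := S2_good hf hfinf.
have [[Cf ffin _ _] C2F pdF] := hf; have [fE _ _ _] := Cvx0_cvx Cf ffin.
have [_ C2G] := hg2; have C1G : C1_off0 G by case: C2G.
pose h := pol F.
have C2S := C2_static C2F.
have gF' (t : R) : 0 <= t -> good F by [].
have pdF' (t : R) x : 0 <= t -> x != 0 -> pos_def (hessian F x) by move=> _; exact: pdF.
(* The regularity of the polar of [f] is that of a constant family, read at time 0. *)
have C2h : C2_off0 h.
  have C2p : C2_spacetime (fun _ : R => h) := C2_pol gF' C2S pdF'.
  exact: (C2_slice C2p (lexx 0)).
have pdh x : x != 0 -> pos_def (hessian h x).
  exact: (pos_def_pol (H := fun=> F) gF' C2S pdF' (lexx 0)).
have gh : good h by apply: (good_pol gF); case: C2h.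
pose H := affine h G; pose W t := pol (H t).
have gH t : 0 <= t -> good (H t) := good_affine gh cG G0 Gp C1G (t := t).
have C2H : C2_spacetime H := C2_affine C2h C2G.
have C1H : C1_spacetime H by case: C2H.
have pdH t x : 0 <= t -> x != 0 -> pos_def (hessian (H t) x).
  by move=> t0 x0; exact: (pos_def_affine cG C2h C2G (pdh x x0) t0 x0).
have polf : polar f = EFin \o h.
  by apply/funext => y; rewrite fE (polarE gF).
(* At [t = 0] this is biduality for [f]; for [t > 0], [polar_scale_polar] turns the second summand
   into [t * g]. *)
have flowE t : 0 <= t -> flow f g t = EFin \o W t.
  rewrite /flow; case: eqVneq => [-> _|tn0 t0].
    have H0 : H 0 = h by apply/funext => x; rewrite /H /affine mul0r addr0.
    apply/funext => x; rewrite /W H0 fE /= /h -[RHS](polarE gh).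
    by rewrite (pol_polarE gF).
  have tp : 0 < t by rewrite lt_neqAle eq_sym tn0.
  apply/funext => x; rewrite /boxdot polf /= -(polarE (gH t t0)).
  congr (polar _ x); apply/funext => y /=.
  by rewrite [in polar g]gE polar_scale_polar.
have C2W : C2_spacetime (fun t x => W t x) := C2_pol gH C2H pdH.
split.
  split.
  - by apply: eq_C2_spacetime C2W => t x t0 x0; rewrite /realpart flowE.
  - move=> t t0; rewrite (flowE t t0).
    apply: (good_S2 (good_pol_family gH C1H t0) (C2_slice C2W t0)) => x x0.
    exact: (pos_def_pol gH C2H pdH t0 x0).
  - move=> t x t0 x0; rewrite /polar_HJ.
    have -> : dt (realpart (flow f g)) t x = dt (fun t x => W t x) t x.
      apply: eq_dt => //; last by case: C2W.
      by move=> s z s0 z0; rewrite /realpart flowE.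
    have -> : realpart (flow f g) t = W t.
      by apply/funext => z; rewrite /realpart flowE.
    rewrite (flowE t t0) (dt_pol gH C1H t0 x0) (grad_pol gH C1H t0 x0).
    set y := touch (H t) x; have y0 : y != 0 by exact: (touch_neq0 (gH t t0)).
    have hy : 0 < H t y by exact: good_gt0 (gH t t0) y0.
    have c : contact (W t) y x (H t y).
      exact: (contact_sym (gH t t0) (touchP (gH t t0) x0)).
    rewrite (legendre_contact hy c) /= invrK scalerA divff ?gt_eqF// scale1r.
    rewrite dt_affine//; last by case: C2h.
    have w0 : 0 < W t x := pol_gt0 (gH t t0) x0.
    by rewrite -/(W t x) mulrN !mulrA mulVf ?gt_eqF// mul1r addrC subrr.
  - by move=> x; rewrite /flow eqxx.
move=> u [C2u Su HJ u0] t x t0; pose U := realpart u.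
have gU s : 0 <= s -> good (U s).
  by move=> s0; have [S2u nu] := Su s s0; exact: S2_good S2u nu.
have uE s : 0 <= s -> u s = EFin \o U s.
  by move=> s0; have [[[Cu uf _ _] _ _] _] := Su s s0; case: (Cvx0_cvx Cu uf).
have C1U : C1_spacetime U by case: C2u.
have U0 : U 0 = F by apply/funext => z; rewrite /U /realpart u0.
(* The equation is used at the contact point [z] of [U s] at [y], where the argument of [g] becomes
   [y]. Although [z] varies with [s], it drops out of the result, which leaves an ordinary equation
   in time for each fixed [y]. *)
have dtW s y : 0 <= s -> y != 0 -> dt (fun t y => pol (U t) y) s y = G y.
  move=> s0 y0; rewrite (dt_pol gU C1U)//; set z := touch (U s) y.
  have z0 : z != 0 by exact: (touch_neq0 (gU s s0)).
  have c : contact (U s) y z (pol (U s) y) by exact: (touchP (gU s s0)).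
  have w0 := pol_gt0 (gU s s0) y0; set w := pol _ _ in c w0 *.
  have [_ _ _ C1s _] := gU s s0; have yE := contact_grad C1s z0 c.
  have pE : grad (U s) z = w^-1 *: y by rewrite yE scalerA mulVf ?scale1r// gt_eqF.
  have := HJ s z s0 z0; rewrite /polar_HJ -/U pE uE// (legendre_contact w0 c) /=.
  rewrite invrK scalerA divff ?gt_eqF// scale1r => /eqP; rewrite addr_eq0 => /eqP e.
  by rewrite -mulrA e mulrN opprK mulrA divff ?gt_eqF// mul1r.
have polU : pol (U t) = H t.
  apply/funext => y; have [->|y0] := eqVneq y 0.
    by rewrite pol0 /H /affine /h pol0 [G 0]G0 mulr0 addr0.
  (* The time derivative does not depend on [s], so a single mean value on [0, t] gives the affine
     formula exactly. *)
  have [s /andP[s0 _]] := dt_MVT (C1_pol gU C1U) (lexx 0) t0 y0.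
  rewrite dtW// U0 subr0 => e.
  by rewrite /H /affine /h; rewrite mulrC -e addrC subrK.
by rewrite uE// flowE// /= -(pol_polarE (gU t t0)) polU (polarE (gH t t0)).
Qed.
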